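(* Let $\mathbb{H}$ be an ordered connected hypergraph. The critical confluence diagrams of the rewriting system $(\Sigma^c_{\mathbb{H}},R^c_{\mathbb{H}})$ are provided by the maximal faces of all the hypergraphs $(\mathbb{H}_Y)_{\cap X}$, for $X\subseteq Y\subseteq H$ with $Y$ connected and $|X|=3$. That is: for every such pair $(X,Y)$, the oriented boundary of the maximal face of $(\mathbb{H}_Y)_{\cap X}$, transported to terms along the bijection $\chi^{-1}$, is a critical confluence diagram (a local confluence diagram for a critical pair); and every critical pair of $(\Sigma^c_{\mathbb{H}},R^c_{\mathbb{H}})$ is the pair of initial edges of such a diagram for some such $(X,Y)$.
   Context: **Hypergraphs.** A hypergraph $\mathbb{H}$ consists of a finite set $H$ of vertices and a set $\mathbb{H}\subseteq\mathcal{P}(H)\setminus\{\emptyset\}$ of hyperedges with $\bigcup\mathbb{H}=H$; it is always assumed atomic, i.e. $\{x\}\in\mathbb{H}$ for all $x\in H$. It is ordered if $H$ carries a total order (inherited by all restrictions). For $X\subseteq H$ put $\mathbb{H}_X=\{Z\in\mathbb{H}\mid Z\subseteq X\}$ and $\mathbb{H}\setminus X=\mathbb{H}_{H\setminus X}$. $\mathbb{H}$ is connected if $H\neq\emptyset$ and there is no partition $H=X_1\sqcup X_2$ into non-empty sets with $\mathbb{H}=\mathbb{H}_{X_1}\cup\mathbb{H}_{X_2}$. A non-empty $X\subseteq H$ is connected if $\mathbb{H}_X$ is. $\mathbb{H},X\leadsto H_1,\dots,H_n$ means that $H_1,\dots,H_n$ are the (vertex sets of the) connected components of $\mathbb{H}\setminus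 X$, listed by increasing order of their maximal vertices. $\mathrm{Sat}(\mathbb{H})$ is the set of connected subsets of $H$. The reconnected restriction of $\mathbb{H}$ to $X$ is $\mathbb{H}_{\cap X}=\{Z\cap X\mid Z\in\mathrm{Sat}(\mathbb{H}),Z\cap X\neq\emptyset\}$. **Constructs.** Constructs of a connected hypergraph $\mathbb{H}$ are non-planar rooted trees defined inductively: the one-node tree decorated by $H$ is a construct; if $\emptyset\ne Y\subseteq H$, $\mathbb{H},Y\leadsto H_1,\dots,H_n$ and $T_i$ is a construct of $\mathbb{H}_{H_i}$ for each $i$, then the tree $Y(T_1,\dots,T_n)$ with root decorated by $Y$ is a construct. A construction is a construct all of whose nodes are singletons. Write $S\prec T$ if $T$ is obtained from $S$ by contracting an edge between a node and its child and labelling the resulting node by the union of the two labels. Constructs ordered by $\prec^*$ are the faces of a polytope; the dimension of a construct is $\sum_{X\text{ node}}(|X|-1)$. For $|X|=3$, the maximal face (the one-node construct $X$) of $(\mathbb{H}_Y)_{\cap X}$ is a polygon whose vertices are the constructions and whose edges are the 1-dimensional constructs. An edge with unique non-singleton node $\{x,y\}$, $x<y$, covers exactly two constructions, one in which $y$ is a child of $x$ and one in which $x$ is a child of $y$; it is oriented from the former to the latter. **Signature $\Sigma^c_{\mathbb{H}}$** (many-sorted). Sorts: connected subsets of $H$. Variables: one variable for each connected subset $Y$, denoted $Y$ and of sort $Y$. Function symbols: $(x,Y)$ with $Y\subseteq H$ connected, $x\in Y$; if $\mathbb{H}_Y,\{x\}\leadsto Y_1,\dots,Y_n$, then $(x,Y)$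 has arity $n$, output sort $Y$, and $i$-th argument of sort $Y_i$. **Rules $R^c_{\mathbb{H}}$.** For each connected $K\subseteq H$ and $x,y\in K$ with $x<y$, let $K_y$ be the component of $\mathbb{H}_K\setminus\{x\}$ containing $y$ and $K_x$ the component of $\mathbb{H}_K\setminus\{y\}$ containing $x$. Let $A_1,\dots,A_a$ be the components of $\mathbb{H}_K\setminus\{x\}$ not containing $y$; $B_1,\dots,B_b$ the components of $\mathbb{H}_{K_y}\setminus\{y\}$; $C_1,\dots,C_c$ the components of $\mathbb{H}_K\setminus\{y\}$ not containing $x$; $D_1,\dots,D_d$ the components of $\mathbb{H}_{K_x}\setminus\{x\}$. The rule is $$(x,K)(A_1,\dots,A_a,(y,K_y)(B_1,\dots,B_b))\to (y,K)(C_1,\dots,C_c,(x,K_x)(D_1,\dots,D_d)),$$ where the $A_i,B_i,C_i,D_i$ are variables and arguments are written up to the reordering prescribed by the signature. **Bijection $\chi$.** For $X\subseteq Y$ with $Y$ connected and $X\neq\emptyset$, $\chi$ is the bijection from terms $t$ over $\Sigma^c_{\mathbb{H}}$ of sort $Y$ whose variables have union $Y\setminus X$ to constructions of $(\mathbb{H}_Y)_{\cap X}$, projecting each function symbol $(z,Z)$ to $z$ and pruning all variables. **Critical pairs.** A rewriting step is $C[\sigma(l)]\to C[\sigma(r)]$ for a rule $l\to r$, a sort-preserving substitution $\sigma$ and a one-hole context $C$. A critical pair is a pair of distinct steps $s\to t_1$, $s\to t_2$ which overlap (the sets of positions of $s$ occupied by the function symbols of the two rules' left-hand sides intersect) and which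 are minimal: the pair is not obtained from another pair $s'\to t_1'$, $s'\to t_2'$ by placing it in a context other than the bare hole, nor by applying a substitution that is not the identity on the variables of $s'$. A local confluence diagram for a pair $s\to t_1,s\to t_2$ consists of it together with reductions $t_1\to^* t\,{}^*\!\!\leftarrow t_2$. *)

(* Defs.v *)
From HB Require Import structures.
From mathcomp Require Import all_boot all_order.
From Stdlib Require List.

Set Implicit Arguments.
Unset Strict Implicit.
Unset Printing Implicit Defensive.

Import Order.TTheory.

Section Hypergraphs.
Variables (d : Order.disp_t) (T : finOrderType d).
Implicit Types (E : {set {set T}}) (X Y Z W : {set T}).

(* A hypergraph is represented by its set E of hyperedges; since the
   hyperedges cover the vertices, its vertex set is [cover E].  The total
   order on the vertices is that of the ambient type T. *)
Definition hypergraph E : Prop :=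
  set0 \notin E /\ (forall x, x \in cover E -> [set x] \in E).

Definition restr E X : {set {set T}} := [set Z in E | Z \subset X].

Definition remove E X : {set {set T}} := restr E (cover E :\: X).

Definition connected E : bool :=
  (cover E != set0) &&
  [forall X1 : {set T}, forall X2 : {set T},
     ~~ [&& X1 != set0, X2 != set0, [disjoint X1 & X2],
            X1 :|: X2 == cover E & E == restr E X1 :|: restr E X2]].

(* A connected X is non-empty because [cover (restr E X) \subset X]. *)
Definition Sat E : {set {set T}} :=
  [set X : {set T} | (X \subset cover E) && connected (restr E X)].

(* On non-empty sets, this is "max Z <= max W". *)
Definition max_le Z W : bool :=
  [exists w in W, forall z in Z, (z <= w)%O].

(* The list H_1, ..., H_n such that E, X ~> H_1, ..., H_n. *)
Definition components E X : seq {set T} :=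
  sort max_le (enum [set Z | maxset (fun W => W \in Sat (remove E X)) Z]).

Definition reconnected E X : {set {set T}} :=
  [set Z :&: X | Z in Sat E & Z :&: X != set0].

End Hypergraphs.

(* Trees with nodes decorated by sets.  The trees considered are non-planar;
   a non-planar tree is represented by the planar one where the children of
   each node are listed by increasing maximal vertex of their support, as the
   connected components are in [components]. *)
Inductive ctree (T : finType) : Type :=
  CNode of {set T} & seq (ctree T).

Section CtreeEq.
Variable T : finType.

Fixpoint ctree_encode (t : ctree T) : GenTree.tree {set T} :=
  let: CNode Y ts := t in
  GenTree.Node 0 (GenTree.Leaf Y :: map ctree_encode ts).

Fixpoint ctree_decode (g : GenTree.tree {set T}) : option (ctree T) :=
  match g with
  | GenTree.Node _ (GenTree.Leaf Y :: gs) =>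
      Some (CNode Y (pmap ctree_decode gs))
  | _ => None
  end.

Lemma ctree_encodeK : pcancel ctree_encode ctree_decode.
Proof.
rewrite /pcancel; fix IH 1 => -[Y ts] /=; congr (Some (CNode Y _)).
by elim: ts => //= t ts ->; rewrite IH.
Qed.

HB.instance Definition _ := Equality.copy (ctree T) (pcan_type ctree_encodeK).

End CtreeEq.

Section Constructs.
Variables (d : Order.disp_t) (T : finOrderType d).
Implicit Types (E : {set {set T}}) (X Y Z : {set T}) (x y : T).
Implicit Types (t u v : ctree T) (ts us : seq (ctree T)).

Definition label t : {set T} := let: CNode Y _ := t in Y.

Fixpoint labels t : seq {set T} :=
  let: CNode Y ts := t in Y :: flatten (map labels ts).

Definition support t : {set T} := \bigcup_(Y <- labels t) Y.

Definition tree_le t u : bool := max_le (support t) (support u).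

(* The one-node tree decorated by all vertices is the case Y = cover E, for
   which there are no components. *)
Fixpoint construct E t {struct t} : bool :=
  let: CNode Y ts := t in
  [&& Y != set0, Y \subset cover E
    & all2 (fun t Z => construct (restr E Z) t) ts (components E Y)].

Definition construction E t : bool :=
  construct E t && all (fun Y => #|Y| == 1) (labels t).

Definition dim t : nat := \sum_(Y <- labels t) (#|Y| - 1).

Inductive contract : ctree T -> ctree T -> Prop :=
| contract_root Y Z ts1 us ts2 :
    contract (CNode Y (ts1 ++ CNode Z us :: ts2))
             (CNode (Y :|: Z) (sort tree_le (ts1 ++ us ++ ts2)))
| contract_sub Y t t' ts1 ts2 :
    contract t t' ->
    contract (CNode Y (ts1 ++ t :: ts2)) (CNode Y (ts1 ++ t' :: ts2)).

(* Some node of t decorated by Z is a child of a node decorated by Y. *)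
Fixpoint is_child Z Y t : bool :=
  let: CNode W ts := t in
  ((W == Y) && has (fun u => label u == Z) ts) || has (is_child Z Y) ts.

Record oedge := OEdge { osrc : ctree T; oface : ctree T; otgt : ctree T }.

(* The 1-dimensional construct [oface e] of E, with the two constructions that
   it covers, oriented from [osrc e] to [otgt e]. *)
Definition is_oedge E (e : oedge) : Prop :=
  [/\ construct E (oface e) /\ dim (oface e) = 1,
      construction E (osrc e) /\ construction E (otgt e),
      contract (osrc e) (oface e) /\ contract (otgt e) (oface e)
    & exists x y, [/\ (x < y)%O, [set x; y] \in labels (oface e),
        is_child [set y] [set x] (osrc e) & is_child [set x] [set y] (otgt e)]].

Fixpoint oedge_path E u (p : seq oedge) v : Prop :=
  if p is e :: p' then
    [/\ is_oedge E e, osrc e = u & oedge_path E (otgt e) p' v]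
  else u = v.

(* The boundary of the polygon E (with three vertices) consists of two
   directed paths p and q with common endpoints: every vertex of the polygon
   lies exactly once, and every edge exactly once, on the cycle formed by p
   followed by the reverse of q. *)
Definition oriented_boundary E (p q : seq oedge) : Prop :=
  exists u v,
    [/\ oedge_path E u p v, oedge_path E u q v,
        (let vs := u :: map otgt p ++ behead (map osrc q) in
         uniq vs /\ forall w, (w \in vs) = construction E w)
      & (let es := map oface (p ++ q) in
         uniq es /\ forall e, (e \in es) = construct E e && (dim e == 1))].

End Constructs.

(* [Var Y] is the variable Y, and [App x Y ts] is the application of the
   function symbol (x, Y). *)
Inductive term (T : finType) : Type :=
| Var of {set T}
| App of T & {set T} & seq (term T).

Inductive context (T : finType) : Type :=
| Hole
| CApp of T & {set T} & seq (term T) & context T & seq (term T).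

Arguments Hole {T}.

Section Rewriting.
Variables (d : Order.disp_t) (T : finOrderType d).
Implicit Types (E : {set {set T}}) (K X Y Z : {set T}) (x y : T).
Implicit Types (s t : term T) (C D : context T) (sigma : {set T} -> term T).

Definition sort_of t : {set T} :=
  match t with Var Y => Y | App _ Y _ => Y end.

Fixpoint well_sorted E t : bool :=
  match t with
  | Var Y => Y \in Sat E
  | App x Y ts =>
      [&& Y \in Sat E, x \in Y, all (well_sorted E) ts
        & map sort_of ts == components (restr E Y) [set x]]
  end.

Fixpoint vars t : seq {set T} :=
  match t with
  | Var Y => [:: Y]
  | App _ _ ts => flatten (map vars ts)
  end.

Fixpoint subst sigma t : term T :=
  match t with
  | Var Y => sigma Y
  | App x Y ts => App x Y (map (subst sigma) ts)
  end.

Definition sort_preserving E sigma : Prop :=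
  forall Y, Y \in Sat E -> well_sorted E (sigma Y) /\ sort_of (sigma Y) = Y.

Fixpoint fill C t : term T :=
  match C with
  | Hole => t
  | CApp x Y ts1 C' ts2 => App x Y (ts1 ++ fill C' t :: ts2)
  end.

(* A position is the list of argument indices followed from the root. *)
Fixpoint hole_position C : seq nat :=
  match C with
  | Hole => [::]
  | CApp _ _ ts1 C' _ => size ts1 :: hole_position C'
  end.

Fixpoint symbol_at t (p : seq nat) {struct p} : bool :=
  match p, t with
  | [::], App _ _ _ => true
  | i :: p', App _ _ ts => symbol_at (nth (Var set0) ts i) p'
  | _, Var _ => false
  end.

(* The term (x,K)(A_1,...,A_a,(y,K_y)(B_1,...,B_b)), with the arguments in the
   order prescribed by the signature.  The right-hand side of a rule is
   obtained from its left-hand side by exchanging x and y. *)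
Definition rule_side E K x y : term T :=
  App x K
    [seq if y \in Z then App y Z (map (@Var T) (components (restr E Z) [set y]))
         else Var Z
    | Z <- components (restr E K) [set x]].

Definition is_rule E K x y : Prop :=
  [/\ K \in Sat E, x \in K, y \in K & (x < y)%O].

Record step := Step {
  src : term T;
  tgt : term T;
  pos : seq nat;
  rule_sort : {set T};
  rule_x : T;
  rule_y : T }.

Definition lhs E (a : step) := rule_side E (rule_sort a) (rule_x a) (rule_y a).
Definition rhs E (a : step) := rule_side E (rule_sort a) (rule_y a) (rule_x a).

(* The context of a step is determined by its source and position, and the
   relevant part of the substitution by its source, position and rule; so they
   are not recorded in [step]. *)
Definition is_step E (a : step) : Prop :=
  [/\ well_sorted E (src a), is_rule E (rule_sort a) (rule_x a) (rule_y a)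
    & exists C sigma,
      [/\ sort_preserving E sigma, hole_position C = pos a,
          src a = fill C (subst sigma (lhs E a))
        & tgt a = fill C (subst sigma (rhs E a))]].

Definition step_in_context D (a : step) : step :=
  Step (fill D (src a)) (fill D (tgt a)) (hole_position D ++ pos a)
       (rule_sort a) (rule_x a) (rule_y a).

Definition step_subst sigma (a : step) : step :=
  Step (subst sigma (src a)) (subst sigma (tgt a)) (pos a)
       (rule_sort a) (rule_x a) (rule_y a).

Definition step_pair E (a b : step) : Prop :=
  [/\ is_step E a, is_step E b, src a = src b & a <> b].

Definition overlap E (a b : step) : Prop :=
  exists p q, [/\ symbol_at (lhs E a) p, symbol_at (lhs E b) q
                & pos a ++ p = pos b ++ q].

Definition critical_pair E (a b : step) : Prop :=
  [/\ step_pair E a b, overlap E a b,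
      (forall a' b' D, step_pair E a' b' ->
         a = step_in_context D a' -> b = step_in_context D b' -> D = Hole)
    & (forall a' b' sigma, step_pair E a' b' -> sort_preserving E sigma ->
         a = step_subst sigma a' -> b = step_subst sigma b' ->
         forall Z, Z \in vars (src a') -> sigma Z = Var Z)].

Fixpoint reduction E s (l : seq step) t : Prop :=
  if l is a :: l' then
    [/\ is_step E a, src a = s & reduction E (tgt a) l' t]
  else s = t.

(* The diagram whose two sides are the reductions a :: la and b :: lb. *)
Definition critical_confluence_diagram E a la b lb : Prop :=
  critical_pair E a b /\
  exists t, reduction E (tgt a) la t /\ reduction E (tgt b) lb t.

(* Children are sorted again after pruning: the maximal vertex of a component
   may be among the vertices pruned. *)
Fixpoint chi t : option (ctree T) :=
  match t with
  | Var _ => None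
  | App z _ ts => Some (CNode [set z] (sort (@tree_le d T) (pmap chi ts)))
  end.

(* [t] is the image under chi^-1 of the construction [u] of
   [reconnected (restr E Y) X]. *)
Definition chi_inv E X Y (u : ctree T) t : Prop :=
  [/\ well_sorted E t, sort_of t = Y, \bigcup_(Z <- vars t) Z = Y :\: X
    & chi t = Some u].

Definition transported E X Y (e : oedge T) (a : step) : Prop :=
  chi_inv E X Y (osrc e) (src a) /\ chi_inv E X Y (otgt e) (tgt a).

(* The diagram with sides l and m is the oriented boundary of the maximal face
   of [reconnected (restr E Y) X], transported along chi^-1. *)
Definition boundary_diagram E X Y (l m : seq step) : Prop :=
  exists p q, [/\ oriented_boundary (reconnected (restr E Y) X) p q,
    List.Forall2 (transported E X Y) p l & List.Forall2 (transported E X Y) q m].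

End Rewriting.

(* Main.v *)
From HB Require Import structures.
Require Import Defs.
From mathcomp Require Import all_boot all_order.

(** Let [X] consist of the vertices [a < b < c] of the connected set [Y].

The terms of sort [Y] whose function symbols carry the vertices of [X] are
obtained by removing these vertices one after the other in some order, each from
the component in which it lies ([priority_term]), and the constructions of the
polygon of [X] are obtained in the same way ([tree3]); pruning the variables
turns the former into the latter ([chi_priority3]).  So both are indexed by the
six permutations of [a], [b], [c], where two permutations are identified when
they differ in the order of the last two letters and the first letter separates
these ([tree3C], [priority_term_swap]).

Exchanging the first two letters of a permutation is an application of a rule at
the root ([is_step_root]) and an edge of the polygon.  Exchanging the last two
letters is an application of a rule in the component containing both
([is_step_sub]) and an edge, or changes nothing.  Hence the two sides
abc, acb, cab, cba and abc, bac, bca, cba of the hexagon of permutations, without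
the exchanges that change nothing, are at once the oriented boundary of the
polygon ([oriented_boundary_sides]) and two reductions from the same term to the
same term ([reduction_steps_c], [reduction_steps_b]).  Their first steps form a
critical pair: the source has three function symbols only, and two different
overlapping rules involve at least three vertices ([critical_pair_of_size]).

Conversely, consider a critical pair.  A common outer context could be removed
([critical_pair_prefix]), so one step is at the root, with a rule that moves a
vertex [y] above the root [x].  The other step either is at the root as well, and
moves up a vertex from a component that does not contain [y]
([critical_pair_root]), or it is at [y], and moves up a vertex from the component
of [y] ([critical_pair_below]).  In both cases there is a third vertex, the two
matches combine into a match of the term that removes the three vertices
([subst_glue]), and minimality for substitutions makes the source equal to that
term ([critical_pair_eq]). *)

Set Implicit Arguments.
Unset Strict Implicit.
Unset Printing Implicit Defensive.

Import Order.TTheory.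

(** * Connected sets and their components *)

Section HypergraphTheory.
Variables (d : Order.disp_t) (T : finOrderType d).
Implicit Types (E : {set {set T}}) (A U V W X Y Z : {set T}) (x y v : T).

Definition component E U Z : bool :=
  maxset (fun W => (W \in Sat E) && (W \subset U)) Z.

(** These are the sorts of the arguments of the function symbol [(x, Y)]. *)
Definition comps E Y x : seq {set T} := components (restr E Y) [set x].

Lemma in_restr E X Z : (Z \in restr E X) = (Z \in E) && (Z \subset X).
Proof. by rewrite inE. Qed.

Lemma restr_restr E X Y : Y \subset X -> restr (restr E X) Y = restr E Y.
Proof.
move=> sYX; apply/setP=> Z; rewrite !in_restr -andbA; congr (_ && _).
by apply/andb_idl => /subset_trans ->.
Qed.

Lemma cover_restr E X :
  hypergraph E -> X \subset cover E -> cover (restr E X) = X.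
Proof.
case=> _ atE sXE; apply/eqP; rewrite eqEsubset; apply/andP; split.
  by apply/bigcupsP => Z; rewrite in_restr => /andP[].
apply/subsetP=> x xX; apply/bigcupP; exists [set x]; last by rewrite inE.
by rewrite in_restr sub1set xX atE // (subsetP sXE).
Qed.

Lemma hypergraph_restr E X :
  hypergraph E -> X \subset cover E -> hypergraph (restr E X).
Proof.
move=> hE sXE; split=> [|x]; first by rewrite in_restr (negPf hE.1).
rewrite cover_restr // in_restr sub1set => xX.
by rewrite xX hE.2 // (subsetP sXE).
Qed.

(** A single set [A] replaces the two parts of a partition: the same [A] tests [X]
and any larger set, which is what unions need. *)
Lemma SatP E X : hypergraph E ->
  reflect [/\ X \subset cover E, X != set0
            & forall A, (forall Z, Z \in E -> Z \subset X ->
                          (Z \subset A) || [disjoint Z & A]) ->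
                (X \subset A) || [disjoint X & A]]
          (X \in Sat E).
Proof.
move=> hE; rewrite inE /connected.
case sXE: (X \subset cover E); last by constructor=> -[].
rewrite cover_restr //=; case X0: (X != set0) => /=; last by constructor=> -[].
apply: (iffP idP) => [/forallP cX | [_ _ cX]].
  split=> // A sepA.
  apply: contraT; rewrite negb_or -setD_eq0 -setI_eq0 => /andP[XD XI].
  have /forallP/(_ (X :\: A))/negP[] := cX (X :&: A).
  apply/and5P; split=> //; last 2 first.
  - by rewrite setID.
  - apply/eqP/setP => Z; rewrite in_setU !restr_restr ?subsetIl ?subsetDl //.
    rewrite !in_restr -andb_orr; case ZE: (Z \in E) => //=.
    rewrite subsetI subsetD; case ZX: (Z \subset X) => //=.
    by apply/esym; exact: sepA.
  - by rewrite disjoints_subset setCD subIset // subsetUr orbT.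
apply/forallP => X1; apply/forallP => X2; apply/negP.
case/and5P=> X10 X20 dX eX /eqP eE.
have: (X \subset X1) || [disjoint X & X1].
  apply: cX => Z ZE ZX; have : Z \in restr E X by rewrite in_restr ZE.
  rewrite eE in_setU !in_restr => /orP[] /andP[_]; first by move->.
  by move=> s2; rewrite orbC (disjointWl s2) // disjoint_sym.
case/orP.
- rewrite -(eqP eX) subUset subxx /= => s21.
  case/negP: X20; rewrite -subset0 -(eqP (_ : X1 :&: X2 == set0)) ?setI_eq0 //.
  by rewrite subsetI s21 subxx.
- move=> dX1; case/negP: X10; rewrite -subset0.
  rewrite -(eqP (_ : X :&: X1 == set0)) ?setI_eq0 // subsetI subxx.
  by rewrite -(eqP eX) subsetUl.
Qed.

Lemma Sat_cover E X : X \in Sat E -> X \subset cover E.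
Proof. by rewrite inE => /andP[]. Qed.

Lemma Sat_neq0 E X : hypergraph E -> X \in Sat E -> X != set0.
Proof. by move=> hE /(SatP _ hE)[]. Qed.

Lemma Sat_restr E Y Z : hypergraph E -> Y \subset cover E ->
  (Z \in Sat (restr E Y)) = (Z \in Sat E) && (Z \subset Y).
Proof.
move=> hE sYE; rewrite !inE cover_restr //.
case sZY: (Z \subset Y) => /=; last by rewrite andbF.
by rewrite andbT (subset_trans sZY) // restr_restr.
Qed.

Lemma Sat_edge E Z : hypergraph E -> Z \in E -> Z \in Sat E.
Proof.
move=> hE ZE; apply/SatP => //; split; first exact: bigcup_sup.
  by apply: contraTneq ZE => ->; exact: hE.1.
by move=> A; apply.
Qed.

Lemma Sat1 E x : hypergraph E -> x \in cover E -> [set x] \in Sat E.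
Proof. by move=> hE xE; apply/Sat_edge/hE.2. Qed.

(** A set of vertices that splits no hyperedge contains or avoids [X], and
likewise [Y]; the common vertex [v] forces the same choice for both. *)
Lemma SatU E X Y v : hypergraph E -> X \in Sat E -> Y \in Sat E ->
  v \in X -> v \in Y -> X :|: Y \in Sat E.
Proof.
move=> hE /(SatP _ hE)[sX X0 cX] /(SatP _ hE)[sY Y0 cY] vX vY.
apply/SatP => //; split; first by rewrite subUset sX.
  by apply/set0Pn; exists v; rewrite inE vX.
move=> A sepA.
have {}cX: (X \subset A) || [disjoint X & A].
  by apply: cX => Z ZE ZX; apply: sepA => //; apply: (subset_trans ZX); apply: subsetUl.
have {}cY: (Y \subset A) || [disjoint Y & A].
  by apply: cY => Z ZE ZX; apply: sepA => //; apply: (subset_trans ZX); apply: subsetUr.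
rewrite subUset -!setI_eq0 setIUl setU_eq0 !setI_eq0.
case/orP: cX => cX; case/orP: cY => cY; rewrite ?cX ?cY ?orbT //=.
- by have := disjointFr cY vY; rewrite (subsetP cX).
- by have := disjointFr cX vX; rewrite (subsetP cY).
Qed.

Lemma component_Sat E U Z : component E U Z -> Z \in Sat E.
Proof. by move/maxsetp => /andP[]. Qed.

Lemma component_sub E U Z : component E U Z -> Z \subset U.
Proof. by move/maxsetp => /andP[]. Qed.

(** A component absorbs every connected set that meets it, since the union is
again connected. *)
Lemma component_max E U Z S v : hypergraph E -> component E U Z -> S \in Sat E ->
  S \subset U -> v \in S -> v \in Z -> S \subset Z.
Proof.
move=> hE cZ SS SU vS vZ.
have ZU := component_sub cZ; have ZS := component_Sat cZ.
rewrite -(maxsetsup cZ (_ : (Z :|: S \in Sat E) && (Z :|: S \subset U)))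
  ?subsetUl ?subsetUr //.
by rewrite subUset ZU SU (SatU hE ZS SS vZ vS).
Qed.

Lemma component_inj E U Z W v : hypergraph E -> component E U Z -> component E U W ->
  v \in Z -> v \in W -> Z = W.
Proof.
move=> hE cZ cW vZ vW; apply/eqP; rewrite eqEsubset.
by rewrite (component_max hE cW _ _ vZ vW) ?(component_max hE cZ _ _ vW vZ)
  ?(component_Sat cZ) ?(component_Sat cW) ?(component_sub cZ) ?(component_sub cW).
Qed.

Lemma component_ex E U S v : S \in Sat E -> S \subset U -> v \in S ->
  exists2 Z, component E U Z & S \subset Z.
Proof.
move=> SS SU vS.
have pS : (S \in Sat E) && (S \subset U) by rewrite SS.
have [Z cZ sZ] := maxset_exists (P := fun W => (W \in Sat E) && (W \subset U)) pS.
by exists Z.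
Qed.

Lemma mem_components E X Z : hypergraph E ->
  (Z \in components E X) = component E (cover E :\: X) Z.
Proof.
move=> hE; rewrite mem_sort mem_enum inE; apply: maxset_eq => W.
by rewrite /remove Sat_restr // subsetDl.
Qed.

Lemma components_uniq E X : uniq (components E X).
Proof. by rewrite sort_uniq enum_uniq. Qed.

Lemma comps_uniq E Y x : uniq (comps E Y x).
Proof. exact: components_uniq. Qed.

Lemma mem_comps E Y x Z : hypergraph E -> Y \in Sat E ->
  (Z \in comps E Y x) = component E (Y :\ x) Z.
Proof.
move=> hE /Sat_cover YE.
rewrite (mem_components _ _ (hypergraph_restr hE YE)) (cover_restr hE YE).
apply: maxset_eq => W; rewrite Sat_restr // -andbA; congr (_ && _).
by apply: andb_idl => /subset_trans -> //; apply: subsetDl.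
Qed.

Lemma comps_Sat E Y x Z : hypergraph E -> Y \in Sat E -> Z \in comps E Y x ->
  Z \in Sat E.
Proof. by move=> hE YS; rewrite mem_comps // => /component_Sat. Qed.

Lemma comps_sub E Y x Z : hypergraph E -> Y \in Sat E -> Z \in comps E Y x ->
  Z \subset Y :\ x.
Proof. by move=> hE YS; rewrite mem_comps // => /component_sub. Qed.

Lemma comps_inj E Y x Z W v : hypergraph E -> Y \in Sat E ->
  Z \in comps E Y x -> W \in comps E Y x -> v \in Z -> v \in W -> Z = W.
Proof. by move=> hE YS; rewrite !mem_comps //; apply: component_inj. Qed.

Lemma comps_ex E Y x y : hypergraph E -> Y \in Sat E -> y \in Y -> y != x ->
  exists2 Z, Z \in comps E Y x & y \in Z.
Proof.
move=> hE YS yY yx; have yE: y \in cover E by rewrite (subsetP (Sat_cover YS)).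
have [||Z cZ yZ] := @component_ex E (Y :\ x) _ y (Sat1 hE yE).
- by rewrite sub1set !inE yx.
- by rewrite inE.
by exists Z; [rewrite mem_comps | rewrite -sub1set].
Qed.

(** The components of what remains after several removals do not depend on the
order of the removals: a component of [Y] minus [A] and [x] lives inside one
component of [Y] minus [x], and is still maximal there. *)
Lemma component_comps E Y x A Z : hypergraph E -> Y \in Sat E ->
  reflect (exists2 V, V \in comps E Y x & component E (V :\: A) Z)
          (component E (Y :\: (x |: A)) Z).
Proof.
move=> hE YS; apply: (iffP idP) => [cZ | [V VY cZ]].
  have ZS := component_Sat cZ; have /set0Pn[v vZ] := Sat_neq0 hE ZS.
  have ZU := component_sub cZ.
  have ZYx: Z \subset Y :\ x by apply: (subset_trans ZU); rewrite -setDDl subsetDl.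
  have [V cV ZV] := component_ex ZS ZYx vZ.
  exists V; first by rewrite mem_comps.
  apply/maxsetP; split=> [|W /andP[WS WV] ZW].
    by move: ZU; rewrite ZS -setDDl !subsetD ZV => /andP[_ ->].
  apply: (maxsetsup cZ) => //; rewrite WS (subset_trans WV) //.
  by rewrite -setDDl setSD // (component_sub cV).
have ZS := component_Sat cZ; have /set0Pn[v vZ] := Sat_neq0 hE ZS.
have VS := comps_Sat hE YS VY; move: VY; rewrite mem_comps // => cV.
have ZV := component_sub cZ; have ZV' := subset_trans ZV (subsetDl V A).
apply/maxsetP; split=> [|W /andP[WS WY] ZW].
  by rewrite ZS (subset_trans ZV) // -setDDl setSD // (component_sub cV).
apply: (maxsetsup cZ) => //; rewrite WS subsetD.
move: (WY); rewrite -setDDl subsetD => /andP[WYx ->]; rewrite andbT.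
exact: (component_max hE cV WS WYx (subsetP ZW _ vZ) (subsetP ZV' _ vZ)).
Qed.

End HypergraphTheory.

(** * Components and constructs with few vertices *)

Section SmallHypergraphs.
Variables (d : Order.disp_t) (T : finOrderType d).
Implicit Types (E F G : {set {set T}}) (X Y Z U : {set T}) (x y z v a b c : T).
Implicit Types (t w e : ctree T) (ts : seq (ctree T)).

Lemma sort_pair (S : eqType) (leS : rel S) (s : seq S) (u v : S) :
  perm_eq s [:: u; v] -> leS u v -> ~~ leS v u -> sort leS s = [:: u; v].
Proof.
move=> ps uv vu.
have: s = [:: u; v] \/ s = [:: v; u].
  case: s ps (perm_size ps) => [|u' [|v' []]] // ps _.
  have: u' \in [:: u; v] by rewrite -(perm_mem ps) mem_head.
  rewrite !inE => /orP[] /eqP eu; rewrite eu in ps *; [left | right].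
    by move: ps; rewrite perm_cons => /perm_small_eq -> //.
  have: perm_eq [:: v; v'] [:: v; u].
    by rewrite (permPl ps) -[[:: u; v]]cat1s -[[:: v; u]]cat1s perm_catC.
  by rewrite perm_cons => /perm_small_eq -> //.
case=> ->; rewrite /sort /= ?uv ?(negPf vu) //.
Qed.

Lemma max_le1 x y : max_le [set x] [set y] = (x <= y)%O.
Proof.
apply/exists_inP/idP => [[w]|xy].
  by rewrite inE => /eqP-> /forall_inP; apply; rewrite inE.
by exists y; rewrite ?inE //; apply/forall_inP => z; rewrite inE => /eqP->.
Qed.

Lemma component_self F U Z : U \in Sat F -> component F U Z = (Z == U).
Proof.
move=> US; apply/idP/eqP => [cZ | ->].
  by apply/esym/(maxsetsup cZ); rewrite ?US //= (component_sub cZ).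
apply/maxsetP; split=> [|W /andP[_ WU] UW]; first by rewrite US /=.
by apply/eqP; rewrite eqEsubset WU.
Qed.

Lemma set2_cases y z Z : Z \subset [set y; z] -> Z != set0 ->
  [\/ Z = [set y], Z = [set z] | Z = [set y; z]].
Proof.
move=> sZ Z0; case yZ: (y \in Z); case zZ: (z \in Z).
- constructor 3; apply/eqP; rewrite eqEsubset sZ /=.
  by apply/subsetP => v; rewrite !inE => /orP[] /eqP->.
- constructor 1; apply/eqP; rewrite eqEsubset sub1set yZ andbT.
  apply/subsetP => v vZ; have := subsetP sZ _ vZ.
  by rewrite !inE => /orP[] // /eqP ev; rewrite ev zZ in vZ.
- constructor 2; apply/eqP; rewrite eqEsubset sub1set zZ andbT.
  apply/subsetP => v vZ; have := subsetP sZ _ vZ.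
  by rewrite !inE => /orP[] // /eqP ev; rewrite ev yZ in vZ.
- case/set0Pn: Z0 => v vZ; have := subsetP sZ _ vZ.
  by rewrite !inE => /orP[] /eqP ev; rewrite ev ?yZ ?zZ in vZ.
Qed.

(** Without the hyperedge [{y, z}], the set [{y}] splits no hyperedge inside
[{y, z}]. *)
Lemma Sat_pair F y z : hypergraph F -> y != z -> [set y; z] \in Sat F ->
  [set y; z] \in F.
Proof.
move=> hF yz /(SatP _ hF)[_ _ cyz]; apply: contraT => nF.
have: ([set y; z] \subset [set y]) || [disjoint [set y; z] & [set y]].
  apply: cyz => Z ZF sZ.
  have Z0: Z != set0 by apply: contraTneq ZF => ->; exact: hF.1.
  case: (set2_cases sZ Z0) => eZ; first by rewrite eZ subxx.
    by rewrite eZ disjoints1 inE eq_sym yz orbT.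
  by rewrite -eZ ZF in nF.
rewrite subUset subxx sub1set inE eq_sym (negPf yz) /=.
by rewrite -setI_eq0 => /eqP/setP/(_ y); rewrite !inE eqxx.
Qed.

Lemma components_cover F : components F (cover F) = [::] :> seq {set T}.
Proof.
have cover0 : cover (restr F set0) = set0.
  by apply/eqP; rewrite -subset0; apply/bigcupsP => W; rewrite in_restr => /andP[].
rewrite /components; set S := [set _ | _]; suff ->: S = set0 by rewrite enum_set0.
apply/setP => Z; rewrite !inE; apply/negP => /maxsetp.
rewrite inE /remove setDv cover0 subset0 => /andP[/eqP->].
by rewrite restr_restr // /connected cover0 eqxx.
Qed.

Lemma components_connected F X U : hypergraph F -> cover F :\: X = U ->
  U \in Sat F -> components F X = [:: U].
Proof.
move=> hF eU US; apply: perm_small_eq => //; apply: uniq_perm => //.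
  exact: components_uniq.
by move=> Z; rewrite mem_components // eU component_self // !inE.
Qed.

Lemma components_pair F X y z : hypergraph F -> (y < z)%O ->
  cover F :\: X = [set y; z] -> [set y; z] \notin F ->
  components F X = [:: [set y]; [set z]].
Proof.
move=> hF yz eU nF; have nyz: y != z by rewrite lt_eqF.
have sU: [set y; z] \subset cover F by rewrite -eU subsetDl.
have [yF zF]: y \in cover F /\ z \in cover F.
  by split; apply: (subsetP sU); rewrite !inE eqxx ?orbT.
rewrite /components; apply: sort_pair; last 2 first.
- by rewrite max_le1 ltW.
- by rewrite max_le1 -ltNge.
apply: uniq_perm; rewrite ?enum_uniq //=.
  by rewrite inE andbT; apply: contra_neq nyz => /set1_inj.
move=> Z; rewrite -(mem_sort (@max_le d T)) -/(components F X).
rewrite mem_components // eU !inE.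
apply/idP/orP => [cZ | ].
  have ZS := component_Sat cZ.
  case: (set2_cases (component_sub cZ) (Sat_neq0 hF ZS)) => eZ; rewrite eZ; auto.
  by move: nF; rewrite (Sat_pair hF nyz) // -eZ.
have max1 v : v \in [set y; z] -> component F [set y; z] [set v].
  move=> vU; apply/maxsetP; split=> [|W /andP[WS WU] vW].
    by rewrite Sat1 ?(subsetP sU) // sub1set.
  have W0: W != set0 by apply/set0Pn; exists v; rewrite -sub1set.
  move: vW; case: (set2_cases WU W0) => eW; rewrite eW sub1set.
  - by rewrite inE => /eqP->.
  - by rewrite inE => /eqP->.
  - by move: nF; rewrite (Sat_pair hF nyz) // -eW.
by case=> /eqP->; apply: max1; rewrite !inE eqxx ?orbT.
Qed.

Definition leaf x : ctree T := CNode [set x] [::].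

(** The construction of a hypergraph on [x], [y], [z] that first removes [x],
then [y], then [z]; both orders of [y] and [z] give the same tree when removing
[x] disconnects them. *)
Definition tree3 F x y z : ctree T :=
  CNode [set x]
    (if [set y; z] \in F then [:: CNode [set y] [:: leaf z]]
     else if (y < z)%O then [:: leaf y; leaf z] else [:: leaf z; leaf y]).

Lemma tree3C F x y z : y != z -> [set y; z] \notin F ->
  tree3 F x y z = tree3 F x z y.
Proof.
move=> yz nF; rewrite /tree3 [[set z; y]]setUC (negPf nF).
by case: (ltgtP y z) yz.
Qed.

Lemma construct_set1 F z t : cover F = [set z] ->
  construct F t = (t == leaf z).
Proof.
move=> eF; case: t => Z ts /=; rewrite eF.
apply/and3P/eqP => [[Z0 sZ]|[-> ->]]; last first.
  rewrite -eF components_cover eF subxx; split=> //.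
  by apply/set0Pn; exists z; rewrite inE.
have ->: Z = [set z] by apply/eqP; move: sZ; rewrite subset1 (negPf Z0) orbF.
by rewrite -eF components_cover; case: ts => //= _; rewrite eF.
Qed.

Lemma construct_set2 F y z t : hypergraph F -> y != z ->
  cover F = [set y; z] ->
  construct F t <-> [\/ t = CNode [set y; z] [::], t = CNode [set y] [:: leaf z]
                      | t = CNode [set z] [:: leaf y]].
Proof.
have n0 v U : v \in U -> U != set0 by move=> vU; apply/set0Pn; exists v.
move=> hF yz eF; have cF: components F [set y; z] = [::].
  by rewrite -eF components_cover.
have c1 u v : u != v -> cover F = [set u; v] ->
   components F [set u] = [:: [set v]] /\ cover (restr F [set v]) = [set v].
  move=> uv euv; have vF: v \in cover F by rewrite euv !inE eqxx orbT.
  split; last by rewrite cover_restr // sub1set.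
  apply: components_connected => //; last exact: Sat1.
  rewrite euv; apply/setP => w; rewrite !inE; case: (eqVneq w u) => //= ->.
  by rewrite (negPf uv).
have [cy ry] := c1 _ _ yz eF.
have [cz rz] : components F [set z] = [:: [set y]] /\
    cover (restr F [set y]) = [set y].
  by apply: c1; rewrite // 1?eq_sym // eF setUC.
case: t => Z ts; split=> [/= /and3P[Z0]|[] [-> ->] /=].
- rewrite eF => sZ; case: (set2_cases sZ Z0) => ->.
  + rewrite cy; case: ts => [|t []] //=; rewrite ?andbT ?andbF //.
    by rewrite (construct_set1 _ ry) => /eqP->; constructor 2.
  + rewrite cz; case: ts => [|t []] //=; rewrite ?andbT ?andbF //.
    by rewrite (construct_set1 _ rz) => /eqP->; constructor 3.
  + by rewrite cF; case: ts => //; constructor 1.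
- by rewrite cF eF subxx (n0 y) // !inE eqxx.
- rewrite cy eF sub1set !inE eqxx (n0 y) ?inE //= andbT.
  have := construct_set1 (leaf z) ry; by rewrite eqxx.
- rewrite cz eF sub1set !inE eqxx orbT (n0 z) ?inE //= andbT.
  have := construct_set1 (leaf y) rz; by rewrite eqxx.
Qed.

Lemma set3_cases x y z Z : Z \subset [set x; y; z] -> Z != set0 ->
  Z \in [:: [set x]; [set y]; [set z]; [set x; y]; [set x; z]; [set y; z];
            [set x; y; z]].
Proof.
move=> sZ Z0; rewrite !inE.
case xZ: (x \in Z); last first.
  have sZ': Z \subset [set y; z].
    apply/subsetP => v vZ; have := subsetP sZ _ vZ; rewrite !inE.
    by case: eqP => // ev; rewrite ev xZ in vZ.
  by case: (set2_cases sZ' Z0) => ->; rewrite eqxx ?orbT.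
case: (eqVneq (Z :\ x) set0) => [Zx0 | Zx0].
  suff ->: Z = [set x] by rewrite eqxx.
  by rewrite -(setD1K xZ) Zx0 setU0.
have sZ': Z :\ x \subset [set y; z].
  apply/subsetP => v; rewrite inE => /andP[vx vZ].
  by have := subsetP sZ _ vZ; move: vx; rewrite !inE; case: eqP.
by rewrite -(setD1K xZ); case: (set2_cases sZ' Zx0) => ->;
  rewrite ?setUA eqxx ?orbT.
Qed.

End SmallHypergraphs.

(** * Constructs of a hypergraph on three vertices *)

Section Polygon.
Variables (d : Order.disp_t) (T : finOrderType d).
Implicit Types (E F G : {set {set T}}) (X Y Z U : {set T}) (x y z v a b c : T).
Implicit Types (t w e : ctree T) (ts : seq (ctree T)).

Lemma all2_seq1 (S R : Type) (r : S -> R -> bool) (u : S) (w : R) :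
  all2 r [:: u] [:: w] = r u w.
Proof. exact: andbT. Qed.

(** The vertices of the polygons: every reconnected restriction to three vertices
is a triangle, whatever its hyperedges with two vertices. *)
Definition triangle G x y z : Prop :=
  [/\ hypergraph G, uniq [:: x; y; z] & cover G = [set x; y; z]].

Lemma triangle_swap12 G x y z : triangle G x y z -> triangle G y x z.
Proof.
case=> hG; rewrite /= !inE !negb_or !andbT => /andP[/andP[xy xz] yz] eG.
by split=> //; rewrite 1?eG 1?[[set y; x]]setUC //= !inE !negb_or !andbT eq_sym xy yz.
Qed.

Lemma triangle_swap23 G x y z : triangle G x y z -> triangle G x z y.
Proof.
case=> hG; rewrite /= !inE !negb_or !andbT => /andP[/andP[xy xz] yz] eG.
split=> //; first by rewrite /= !inE !negb_or !andbT xz xy eq_sym.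
by rewrite eG -!setUA [[set z; y]]setUC.
Qed.

(** The two kinds of edges of the polygon, according to whether the node with two
vertices is the root or the child of the root. *)
Definition face_root x y z : ctree T := CNode [set x; y] [:: leaf z].
Definition face_sub x y z : ctree T := CNode [set x] [:: CNode [set y; z] [::]].

Lemma triangle_neq G x y z : triangle G x y z -> [/\ x != y, x != z & y != z].
Proof.
by case=> _ /=; rewrite !inE negb_or andbT => /andP[/andP[-> ->] ->].
Qed.

Lemma triangle_components1 G x y z : triangle G x y z ->
  components G [set x] =
    if [set y; z] \in G then [:: [set y; z]]
    else if (y < z)%O then [:: [set y]; [set z]] else [:: [set z]; [set y]].
Proof.
move=> tG; have [xy xz yz] := triangle_neq tG; case: tG => hG _ eG.
have eU: cover G :\: [set x] = [set y; z].
  rewrite eG; apply/setP => v; rewrite !inE; case: (eqVneq v x) => //= ->.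
  by rewrite (negPf xy) (negPf xz).
case: ifPn => yzG; first exact/components_connected/Sat_edge.
case: ltgtP yz => // ltyz _; first exact: components_pair.
by apply: components_pair => //; rewrite setUC.
Qed.

Lemma triangle_components2 G x y z : triangle G x y z ->
  components G [set x; y] = [:: [set z]].
Proof.
move=> tG; have [xy xz yz] := triangle_neq tG; case: tG => hG _ eG.
apply: components_connected => //; last first.
  by apply: Sat1; rewrite // eG !inE eqxx orbT.
rewrite eG; apply/setP => v; rewrite !inE.
case: (eqVneq v x) => [->|_] /=; first by rewrite (negPf xz).
by case: (eqVneq v y) => [->|_] //=; rewrite (negPf yz).
Qed.

Lemma triangle_construct1 G x y z ts : triangle G x y z ->
  construct G (CNode [set x] ts) <->
  [\/ CNode [set x] ts = tree3 G x y z, CNode [set x] ts = tree3 G x z y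
    | [set y; z] \in G /\ CNode [set x] ts = face_sub x y z].
Proof.
move=> tG; have [xy xz yz] := triangle_neq tG; have [hG _ eG] := tG.
have yG: y \in cover G by rewrite eG !inE eqxx orbT.
have zG: z \in cover G by rewrite eG !inE eqxx orbT.
have sc U : U \subset cover G -> cover (restr G U) = U by apply: cover_restr.
have xU: [set x] != set0 by apply/set0Pn; exists x; rewrite inE.
have xG: [set x] \subset cover G by rewrite eG sub1set !inE eqxx.
rewrite [construct _ _]/= xU xG (triangle_components1 tG) /=.
case: ifPn => [yzG | nG].
  have syz: [set y; z] \subset cover G by rewrite subUset !sub1set yG.
  have c2 t := construct_set2 t (hypergraph_restr hG syz) yz (sc _ syz).
  rewrite /tree3 [[set z; y]]setUC yzG; split.
    case: ts => [|t []] //=; rewrite ?andbT ?andbF // => /c2[] ->.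
    - by constructor 3.
    - by constructor 1.
    - by constructor 2.
  by case=> [||[_]] [->]; rewrite all2_seq1; apply/c2;
    [constructor 2 | constructor 3 | constructor 1].
have c1 v t : v \in cover G -> construct (restr G [set v]) t = (t == leaf v).
  by move=> vG; apply/construct_set1/sc; rewrite sub1set.
rewrite -(tree3C x yz nG) (_ : [\/ _, _ | _] <-> CNode [set x] ts = tree3 G x y z);
  last by split=> [[//|//|[]//]|->]; constructor 1.
rewrite /tree3 (negPf nG).
case: (y < z)%O; split.
- case: ts => [|t [|t' []]] //=; rewrite ?andbF // andbT !c1 //.
  by case/andP=> /eqP-> /eqP->.
- by case=> -> /=; have := c1 _ (leaf y) yG; have := c1 _ (leaf z) zG;
  rewrite !eqxx /= => -> ->.
- case: ts => [|t [|t' []]] //=; rewrite ?andbF // andbT !c1 //.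
  by case/andP=> /eqP-> /eqP->.
- by case=> -> /=; have := c1 _ (leaf y) yG; have := c1 _ (leaf z) zG;
  rewrite !eqxx /= => -> ->.
Qed.

Lemma triangle_construct2 G x y z ts : triangle G x y z ->
  construct G (CNode [set x; y] ts) = (CNode [set x; y] ts == face_root x y z).
Proof.
move=> tG; have [hG _ eG] := tG.
have xU: [set x; y] != set0 by apply/set0Pn; exists x; rewrite !inE eqxx.
have sxy: [set x; y] \subset cover G by rewrite eG subsetUl.
have sz: [set z] \subset cover G by rewrite eG subsetUr.
rewrite /= xU sxy (triangle_components2 tG) /=.
have c1 t := construct_set1 t (cover_restr hG sz).
apply/idP/eqP => [|[->]]; last by rewrite all2_seq1 c1.
by case: ts => [|t []] //=; rewrite ?andbT ?andbF // c1 => /eqP->.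
Qed.

Lemma triangle_construct3 G x y z ts : triangle G x y z ->
  construct G (CNode [set x; y; z] ts) -> ts = [::].
Proof.
by case=> _ _ eG /=; rewrite -eG components_cover => /and3P[_ _]; case: ts.
Qed.

Lemma dim_tree3 G x y z : dim (tree3 G x y z) = 0.
Proof.
rewrite /dim big1_seq // => U /andP[_]; rewrite /tree3 /=.
by case: ifP => _; [|case: ifP => _]; rewrite !inE => /or3P[] /eqP->; rewrite cards1.
Qed.

Lemma dim_face_root G x y z : triangle G x y z -> dim (face_root x y z) = 1.
Proof.
move=> /triangle_neq[xy _ _].
by rewrite /dim /= !big_cons big_nil cards2 cards1 xy.
Qed.

Lemma dim_face_sub G x y z : triangle G x y z -> dim (face_sub x y z) = 1.
Proof.
move=> /triangle_neq[_ _ yz].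
by rewrite /dim /= !big_cons big_nil cards2 cards1 yz.
Qed.

Lemma construction_tree3 G x y z : triangle G x y z ->
  construction G (tree3 G x y z).
Proof.
move=> tG; apply/andP; split.
  by apply/(triangle_construct1 _ tG); constructor 1.
rewrite /tree3 /=.
by case: ifP => _; [|case: ifP => _]; rewrite /= !cards1.
Qed.

(** The root label is one of the seven non-empty sets of vertices: a singleton
leaves a hypergraph on two vertices, a pair leaves a single vertex, and the whole
set gives the construct of dimension 2. *)
Lemma triangle_constructP G a b c t : triangle G a b c -> construct G t ->
  (dim t = 0 -> t \in [:: tree3 G a b c; tree3 G a c b; tree3 G b a c;
                          tree3 G b c a; tree3 G c a b; tree3 G c b a]) /\
  (dim t = 1 ->
    [|| [|| t == face_root a b c, t == face_root a c b | t == face_root b c a],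
        ([set b; c] \in G) && (t == face_sub a b c),
        ([set a; c] \in G) && (t == face_sub b a c)
      | ([set a; b] \in G) && (t == face_sub c a b)]).
Proof.
move=> tG; have tG2 := triangle_swap12 tG; have tG4 := triangle_swap23 tG.
have tG3 := triangle_swap12 tG4; have tG5 := triangle_swap23 tG2.
have in6 i := @mem_nth _ t [:: tree3 G a b c; tree3 G a c b; tree3 G b a c;
                               tree3 G b c a; tree3 G c a b; tree3 G c b a] i.
case: t in6 => Z ts in6 ct; have Z0: Z != set0 by case/and3P: ct.
have [_ _ eG] := tG; have sZ: Z \subset [set a; b; c] by rewrite -eG; case/and3P: ct.
have := set3_cases sZ Z0; rewrite !in_cons in_nil orbF.
case/or4P=> [/eqP eZ|/eqP eZ|/eqP eZ|]; rewrite ?{}eZ in ct *.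
- case: ((triangle_construct1 _ tG).1 ct) => [->|->|[bc ->]].
  + by rewrite dim_tree3; split=> [_|//]; exact: (in6 0 isT).
  + by rewrite dim_tree3; split=> [_|//]; exact: (in6 1 isT).
  + rewrite (dim_face_sub tG); split=> [//|_].
    by apply/or4P; constructor 2; rewrite bc; exact: eqxx.
- case: ((triangle_construct1 _ tG2).1 ct) => [->|->|[ac ->]].
  + by rewrite dim_tree3; split=> [_|//]; exact: (in6 2 isT).
  + by rewrite dim_tree3; split=> [_|//]; exact: (in6 3 isT).
  + rewrite (dim_face_sub tG2); split=> [//|_].
    by apply/or4P; constructor 3; rewrite ac; exact: eqxx.
- case: ((triangle_construct1 _ tG3).1 ct) => [->|->|[ab ->]].
  + by rewrite dim_tree3; split=> [_|//]; exact: (in6 4 isT).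
  + by rewrite dim_tree3; split=> [_|//]; exact: (in6 5 isT).
  + rewrite (dim_face_sub tG3); split=> [//|_].
    by apply/or4P; constructor 4; rewrite ab; exact: eqxx.
case/or4P=> /eqP eZ; rewrite {}eZ in ct *.
- move: ct; rewrite (triangle_construct2 _ tG) => /eqP->.
  rewrite (dim_face_root tG); split=> [//|_].
  by apply/or4P; constructor 1; apply/or3P; constructor 1; exact: eqxx.
- move: ct; rewrite (triangle_construct2 _ tG4) => /eqP->.
  rewrite (dim_face_root tG4); split=> [//|_].
  by apply/or4P; constructor 1; apply/or3P; constructor 2; exact: eqxx.
- move: ct; rewrite (triangle_construct2 _ tG5) => /eqP->.
  rewrite (dim_face_root tG5); split=> [//|_].
  by apply/or4P; constructor 1; apply/or3P; constructor 3; exact: eqxx.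
- have [ab ac bc] := triangle_neq tG.
  rewrite (triangle_construct3 tG ct) /dim /= big_cons big_nil.
  rewrite setUC cardsU1 cards2 !inE ab [c == a]eq_sym [c == b]eq_sym.
  by rewrite (negPf ac) (negPf bc).
Qed.

End Polygon.

(** * The oriented boundary of the polygon *)

Section PolygonBoundary.
Variables (d : Order.disp_t) (T : finOrderType d).
Implicit Types (E F G : {set {set T}}) (X Y Z : {set T}) (x y z a b c : T).
Implicit Types (t u v w : ctree T) (e f : oedge T) (p q : seq (oedge T)).

Lemma contract_tree3_root G x y z :
  contract (tree3 G x y z) (face_root x y z).
Proof.
rewrite /tree3 /face_root; case: ifP => _; [|case: ifP => _].
- exact: (contract_root [set x] [set y] [::] [:: leaf z] [::]).
- exact: (contract_root [set x] [set y] [::] [::] [:: leaf z]).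
- exact: (contract_root [set x] [set y] [:: leaf z] [::] [::]).
Qed.

Lemma contract_tree3_sub G x y z : [set y; z] \in G ->
  contract (tree3 G x y z) (face_sub x y z).
Proof.
move=> yz; rewrite /tree3 yz.
apply/(@contract_sub _ _ [set x] _ _ [::] [::]).
exact: (contract_root [set y] [set z] [::] [::] [::]).
Qed.

Lemma is_child_tree3_root G x y z : is_child [set y] [set x] (tree3 G x y z).
Proof.
by rewrite /tree3 /= eqxx; case: ifP => _ /=; [|case: ifP => _ /=];
  rewrite !eqxx ?orbT.
Qed.

Lemma is_child_tree3_sub G x y z : [set y; z] \in G ->
  is_child [set z] [set y] (tree3 G x y z).
Proof. by rewrite /tree3 => -> /=; rewrite !eqxx !orbT. Qed.

Lemma is_oedge_root G x y z : triangle G x y z -> (x < y)%O ->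
  is_oedge G (OEdge (tree3 G x y z) (face_root x y z) (tree3 G y x z)).
Proof.
move=> tG xy; have tG' := triangle_swap12 tG; split.
- split; last exact: dim_face_root tG.
  by apply: etrans (triangle_construct2 _ tG) _; rewrite eqxx.
- by split; exact: construction_tree3.
- split; first exact: contract_tree3_root.
  by rewrite /face_root setUC; apply: contract_tree3_root.
- by exists x, y; rewrite !is_child_tree3_root xy inE eqxx.
Qed.

Lemma is_oedge_sub G x y z : triangle G x y z -> (y < z)%O ->
  [set y; z] \in G ->
  is_oedge G (OEdge (tree3 G x y z) (face_sub x y z) (tree3 G x z y)).
Proof.
move=> tG xy yzG; have tG' := triangle_swap23 tG; split.
- split; last exact: dim_face_sub tG.
  by apply/(triangle_construct1 _ tG); constructor 3.
- by split; exact: construction_tree3.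
- split; first exact: contract_tree3_sub.
  by rewrite /face_sub setUC; apply: contract_tree3_sub; rewrite setUC.
- exists y, z; rewrite !is_child_tree3_sub ?xy ?inE ?eqxx ?orbT //.
  by rewrite setUC.
Qed.

Lemma oedge_path_cat G u p w q v :
  oedge_path G u p w -> oedge_path G w q v -> oedge_path G u (p ++ q) v.
Proof.
by elim: p u => [u /= ->|e p IH u [oe se pp] qq] //=; split=> //; exact: IH.
Qed.

Lemma oedge_path_vertices G u p v : oedge_path G u p v ->
  u :: map (@otgt d T) p = rcons (map (@osrc d T) p) v.
Proof.
by elim: p u => [u /= ->|e p IH u [_ se pp]] //=; rewrite (IH _ pp) se.
Qed.

(** The two steps of a critical pair come in either order, so both orders of the
sides of a polygon are needed. *)
Lemma oriented_boundaryC G e p f q :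
  oriented_boundary G (e :: p) (f :: q) -> oriented_boundary G (f :: q) (e :: p).
Proof.
case=> u [v [pe pf [uv cv] [ue ce]]]; exists u, v.
move: (oedge_path_vertices pe) (oedge_path_vertices pf) uv cv => ve vf.
rewrite -!cat_cons ve vf => uv cv.
pose vs p q := rcons (map (@osrc d T) p) v ++ behead (map (@osrc d T) q).
have peq : perm_eq (vs (e :: p) (f :: q)) (vs (f :: q) (e :: p)).
  have [_ es _] := pe; have [_ fs _] := pf.
  rewrite /vs /= es fs perm_cons !cat_rcons; apply/permP => P; rewrite !count_cat /=.
  by rewrite addnCA [RHS]addnCA [X in _ = _ + X]addnC.
have pee : perm_eq (map (@oface d T) ((e :: p) ++ (f :: q)))
                   (map (@oface d T) ((f :: q) ++ (e :: p))).
  by rewrite !map_cat; exact/permPl/perm_catC.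
split=> //.
  split; first by rewrite -(perm_uniq peq).
  by move=> w; rewrite -(perm_mem peq).
split; first by rewrite -(perm_uniq pee).
by move=> w; rewrite -(perm_mem pee).
Qed.

(** The two sides of the polygon run over the permutations of [a < b < c] from
[a b c] to [c b a]; the swap of the last two letters is an edge exactly when
these two letters form a hyperedge, and otherwise does not change the tree. *)
Definition side_c G a b c : seq (oedge T) :=
  (if [set b; c] \in G
   then [:: OEdge (tree3 G a b c) (face_sub a b c) (tree3 G a c b)] else [::])
  ++ OEdge (tree3 G a c b) (face_root a c b) (tree3 G c a b)
  :: (if [set a; b] \in G
      then [:: OEdge (tree3 G c a b) (face_sub c a b) (tree3 G c b a)] else [::]).

Definition side_b G a b c : seq (oedge T) :=
  OEdge (tree3 G a b c) (face_root a b c) (tree3 G b a c)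
  :: (if [set a; c] \in G
      then [:: OEdge (tree3 G b a c) (face_sub b a c) (tree3 G b c a)] else [::])
  ++ [:: OEdge (tree3 G b c a) (face_root b c a) (tree3 G c b a)].

Lemma side_c_path G a b c : triangle G a b c -> (a < b)%O -> (b < c)%O ->
  oedge_path G (tree3 G a b c) (side_c G a b c) (tree3 G c b a).
Proof.
move=> tG ab bc; have [nab nac nbc] := triangle_neq tG.
have ac := lt_trans ab bc.
have tG' := triangle_swap23 tG; have tG2 := triangle_swap12 tG'.
apply: (@oedge_path_cat _ _ _ (tree3 G a c b)).
  by case: ifPn => h /=; [split=> //; exact: is_oedge_sub | exact: tree3C].
split=> //=; first exact: is_oedge_root.
by case: ifPn => h /=; [split=> //; exact: is_oedge_sub | exact: tree3C].
Qed.

Lemma side_b_path G a b c : triangle G a b c -> (a < b)%O -> (b < c)%O ->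
  oedge_path G (tree3 G a b c) (side_b G a b c) (tree3 G c b a).
Proof.
move=> tG ab bc; have [nab nac nbc] := triangle_neq tG.
have ac := lt_trans ab bc.
have tG' := triangle_swap12 tG; have tG2 := triangle_swap23 tG'.
split=> //=; first exact: is_oedge_root.
apply: (@oedge_path_cat _ _ _ (tree3 G b c a)).
  by case: ifPn => h /=; [split=> //; exact: is_oedge_sub | exact: tree3C].
by split=> //=; exact: is_oedge_root.
Qed.

Lemma triangle_constructionE G a b c w : triangle G a b c ->
  construction G w = (w \in [:: tree3 G a b c; tree3 G a c b; tree3 G b a c;
                                tree3 G b c a; tree3 G c a b; tree3 G c b a]).
Proof.
move=> t1; have t2 := triangle_swap12 t1; have t3 := triangle_swap23 t1.
have t4 := triangle_swap12 t3; have t5 := triangle_swap23 t2; have t6 := triangle_swap23 t4.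
apply/idP/idP => [/andP[cw /allP lw]|].
  apply: (triangle_constructP t1 cw).1.
  by rewrite /dim big1_seq // => Z /andP[_ /lw /eqP->].
by rewrite !in_cons in_nil orbF => /or4P[|||/or3P[]] /eqP->; exact: construction_tree3.
Qed.

Lemma triangle_edgeE G a b c w : triangle G a b c ->
  construct G w && (dim w == 1) =
  [|| [|| w == face_root a b c, w == face_root a c b | w == face_root b c a],
     ([set b; c] \in G) && (w == face_sub a b c),
     ([set a; c] \in G) && (w == face_sub b a c)
   | ([set a; b] \in G) && (w == face_sub c a b)].
Proof.
move=> t1; have t2 := triangle_swap12 t1; have t3 := triangle_swap23 t1.
have t4 := triangle_swap12 t3; have t5 := triangle_swap23 t2.
have root x y z : triangle G x y z ->
    construct G (face_root x y z) && (dim (face_root x y z) == 1).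
  move=> t; rewrite (dim_face_root t) andbT.
  by apply: etrans (triangle_construct2 _ t) _; rewrite eqxx.
have sub x y z : triangle G x y z -> [set y; z] \in G ->
    construct G (face_sub x y z) && (dim (face_sub x y z) == 1).
  move=> t yz; rewrite (dim_face_sub t) andbT.
  by apply/(triangle_construct1 _ t); constructor 3.
apply/idP/idP => [/andP[cw /eqP dw]|]; first exact: (triangle_constructP t1 cw).2.
case/or4P=> [/or3P[]|/andP[h]|/andP[h]|/andP[h]] /eqP->.
- exact: root t1.
- exact: root t3.
- exact: root t5.
- exact: sub t1 h.
- exact: sub t2 h.
- exact: sub t4 h.
Qed.

(** Each of the six orders of removal occurs on one of the sides, up to the
equalities of [tree3C], and so does each construct of dimension 1; hence the two
sides together run over the whole boundary. *)
Lemma oriented_boundary_sides G a b c :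
  triangle G a b c -> (a < b)%O -> (b < c)%O ->
  oriented_boundary G (side_c G a b c) (side_b G a b c).
Proof.
move=> tG ab bc; exists (tree3 G a b c), (tree3 G c b a).
have [nab nac nbc] := triangle_neq tG; have ac := lt_trans ab bc.
(* Different trees below have different labels, and labels are told apart by which
   of [a], [b], [c] they contain. *)
pose code (t : ctree T) :=
  [seq [:: a \in Z; b \in Z; c \in Z] | Z : {set T} <- labels t].
have [nba nca ncb]: [/\ b != a, c != a & c != b] by split; rewrite eq_sym.
have simp := (negPf nab, negPf nac, negPf nbc, negPf nba, negPf nca, negPf ncb).
have ltF := (lt_gtF ab, lt_gtF ac, lt_gtF bc).
split; [exact: side_c_path | exact: side_b_path | split | split].
- apply: (@map_uniq _ _ code).
  rewrite /side_c /side_b /tree3 /code ab ac bc !ltF.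
  rewrite [[set c; b]]setUC [[set c; a]]setUC [[set b; a]]setUC.
  by case: ifP => _; case: ifP => _; case: ifP => _; rewrite /= !inE !eqxx !simp.
- move=> w; rewrite (triangle_constructionE w tG) /side_c /side_b.
  case: (boolP ([set b; c] \in G)) => [_|/(tree3C a nbc)->];
  case: (boolP ([set a; b] \in G)) => [_|/(tree3C c nab)->];
  case: (boolP ([set a; c] \in G)) => [_|/(tree3C b nac)->];
  (* Generalized trees keep the comparisons below symbolic. *)
  move: (tree3 G a b c) (tree3 G a c b) (tree3 G b a c) (tree3 G b c a)
        (tree3 G c a b) (tree3 G c b a) => t_abc t_acb t_bac t_bca t_cab t_cba;
  rewrite /= !in_cons in_nil;
  move: (w == t_abc) (w == t_acb) (w == t_bac) (w == t_bca) (w == t_cab) (w == t_cba);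
  by do 6!case.
- apply: (@map_uniq _ _ code).
  rewrite /side_c /side_b /code.
  by case: ifP => _; case: ifP => _; case: ifP => _; rewrite /= !inE !eqxx !simp.
- move=> w; rewrite (triangle_edgeE w tG) /side_c /side_b.
  move: (face_root a b c) (face_root a c b) (face_root b c a)
        (face_sub a b c) (face_sub b a c) (face_sub c a b) => e1 e2 e3 e4 e5 e6.
  case: ifP => _; case: ifP => _; case: ifP => _; rewrite /= !in_cons in_nil;
  move: (w == e1) (w == e2) (w == e3) (w == e4) (w == e5) (w == e6);
  by do 6!case.
Qed.

End PolygonBoundary.

(** * Terms, contexts and substitutions *)

Section TermTheory.
Variables (d : Order.disp_t) (T : finOrderType d).
Implicit Types (Y Z : {set T}) (x y : T) (s t u : term T) (ts : seq (term T)).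
Implicit Types (C D : context T) (p q : seq nat).

Lemma term_nested_ind (P : term T -> Prop) :
  (forall Y, P (Var Y)) ->
  (forall x Y ts, List.Forall P ts -> P (App x Y ts)) -> forall t, P t.
Proof.
move=> PV PA; fix IH 1 => -[Y | x Y ts]; first exact: PV.
apply: PA; elim: ts => [|t ts IHts]; constructor; [exact: IH | exact: IHts].
Qed.

(** Counting function symbols is what detects the substitutions that are not
renamings. *)
Fixpoint syms t : seq T :=
  match t with
  | Var _ => [::]
  | App x _ ts => x :: flatten (map syms ts)
  end.

Lemma fill_inj C D s t : hole_position C = hole_position D ->
  fill C s = fill D t -> C = D /\ s = t.
Proof.
elim: C D => [|x Y ts1 C IH ts2] [|x' Y' ts1' D ts2'] //= [es ep] [-> -> ets].
have sz (S : Type) (l1 l1' l2 l2' : seq S) : size l1 = size l1' ->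
    l1 ++ l2 = l1' ++ l2' -> l1 = l1' /\ l2 = l2'.
  elim: l1 l1' => [|v l1 IHl] [|v' l1'] //= [/IHl{}IHl] [-> /IHl[-> ->]] //.
by have [-> [/(IH _ ep)[-> ->] ->]] := sz _ _ _ _ _ es ets.
Qed.

Fixpoint compose C D : context T :=
  match C with
  | Hole => D
  | CApp x Y ts1 C' ts2 => CApp x Y ts1 (compose C' D) ts2
  end.

Lemma fill_compose C D t : fill (compose C D) t = fill C (fill D t).
Proof. by elim: C => //= x Y ts1 C -> ts2. Qed.

Lemma context_split C p q : hole_position C = p ++ q ->
  exists C1 C2, [/\ C = compose C1 C2, hole_position C1 = p & hole_position C2 = q].
Proof.
elim: p C => [|i p IH] C /=; first by exists Hole, C.
case: C => //= x Y ts1 C ts2 [<- /IH[C1 [C2 [-> e1 e2]]]].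
by exists (CApp x Y ts1 C1 ts2), C2; rewrite /= e1.
Qed.

Lemma syms_fill C t : {subset syms t <= syms (fill C t)}.
Proof.
move=> x xt; elim: C => //= y Y ts1 C IH ts2.
by rewrite inE map_cat flatten_cat mem_cat /= mem_cat IH !orbT.
Qed.

Lemma syms_subst sigma t : {subset syms t <= syms (subst sigma t)}.
Proof.
elim/term_nested_ind: t => //= y Y ts IH x; rewrite !inE => /orP[->//|].
suff sub: {subset flatten (map syms ts) <= flatten (map syms (map (subst sigma) ts))}.
  by move/sub->; rewrite orbT.
elim: IH => //= t ts' IHt _ IHts z; rewrite !mem_cat.
by case/orP=> [/IHt->//|/IHts->]; rewrite orbT.
Qed.

Lemma size_syms_subst sigma t :
  size (syms (subst sigma t)) =
    size (syms t) + sumn [seq size (syms (sigma Z)) | Z <- vars t].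
Proof.
elim/term_nested_ind: t => [Y|x Y ts IH] /=; first by rewrite addn0.
rewrite addSn; congr _.+1; elim: IH => //= t ts' IHt _ IHts.
by rewrite !size_cat map_cat sumn_cat IHt IHts addnACA.
Qed.

Lemma subst_comp sigma tau t :
  subst sigma (subst tau t) = subst (fun Z => subst sigma (tau Z)) t.
Proof.
elim/term_nested_ind: t => //= x Y ts IH; congr App.
by elim: IH => //= t ts' -> _ ->.
Qed.

Fixpoint subst_context sigma C : context T :=
  match C with
  | Hole => Hole
  | CApp x Y ts1 C' ts2 =>
      CApp x Y (map (subst sigma) ts1) (subst_context sigma C')
        (map (subst sigma) ts2)
  end.

Lemma subst_fill sigma C t :
  subst sigma (fill C t) = fill (subst_context sigma C) (subst sigma t).
Proof. by elim: C => //= x Y ts1 C IH ts2; rewrite map_cat /= IH. Qed.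

Lemma hole_position_subst sigma C :
  hole_position (subst_context sigma C) = hole_position C.
Proof. by elim: C => //= x Y ts1 C IH ts2; rewrite size_map IH. Qed.

End TermTheory.

Section SortedTerms.
Variables (d : Order.disp_t) (T : finOrderType d).
Implicit Types (E : {set {set T}}) (Y Z : {set T}) (s t u : term T).

Lemma well_sorted_fill E (C : context T) t : well_sorted E (fill C t) -> well_sorted E t.
Proof.
elim: C => //= x Y ts1 C IH ts2 /and4P[_ _ + _].
by rewrite all_cat /= => /and3P[_ /IH].
Qed.

Lemma well_sorted_vars E t Z : well_sorted E t -> Z \in vars t -> Z \in Sat E.
Proof.
elim/term_nested_ind: t => [Y|x Y ts IH] /=; first by rewrite mem_seq1 => YS /eqP->.
case/and4P=> _ _ + _; elim: IH => //= t ts' IHt _ IHts /andP[wt /IHts{}IHts].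
by rewrite mem_cat => /orP[/(IHt wt)|].
Qed.

Lemma well_sorted_subst E sigma t : sort_preserving E sigma -> well_sorted E t ->
  well_sorted E (subst sigma t) /\ sort_of (subst sigma t) = sort_of t.
Proof.
move=> sp; elim/term_nested_ind: t => [Y|x Y ts IH] /=; first exact: sp.
case/and4P=> -> -> + /eqP ets; rewrite -ets => wts; split=> //=.
suff [-> ->]: all (well_sorted E) (map (subst sigma) ts) /\
    map (@sort_of d T) (map (subst sigma) ts) = map (@sort_of d T) ts by rewrite eqxx.
elim: IH wts {ets} => //= t ts' IHt _ IHts /andP[/IHt[-> ->] /IHts[-> ->]] //.
Qed.

Lemma sort_preserving_comp E sigma tau : sort_preserving E sigma ->
  sort_preserving E tau -> sort_preserving E (fun Z => subst sigma (tau Z)).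
Proof.
by move=> ss st Y /st[wt et]; have [ws es] := well_sorted_subst ss wt; rewrite es.
Qed.

End SortedTerms.

(** * Terms indexed by lists of vertices *)

(** The term of sort [Y] obtained by removing the vertices of [l] one after the
other, each from the component in which it lies.  The sides of the rules are
the case of two vertices, and the terms over a set of three vertices are
indexed by its permutations.  The definition is locked to keep unification from
computing components when it compares two of these terms. *)
HB.lock Definition priority_term (d : Order.disp_t) (T : finOrderType d)
    (E : {set {set T}}) : seq T -> {set T} -> term T :=
  fix priority_term l Y :=
    if l is x :: l' then
      if x \in Y then App x Y (map (priority_term l') (comps E Y x))
      else priority_term l' Y
    else Var Y.

Section PriorityTerms.
Variables (d : Order.disp_t) (T : finOrderType d) (E : {set {set T}}).
Hypothesis hE : hypergraph E.
Implicit Types (U V W X Y Z K : {set T}) (x y z v : T) (l : seq T).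
Implicit Types (s t : term T) (sigma tau : {set T} -> term T).

Notation priority_term := (priority_term E).

Lemma priority_term_nil Y : priority_term [::] Y = Var Y.
Proof. by rewrite priority_term.unlock. Qed.

Lemma priority_term_cons x l Y : x \in Y ->
  priority_term (x :: l) Y = App x Y (map (priority_term l) (comps E Y x)).
Proof. by rewrite priority_term.unlock /= => ->. Qed.

Lemma priority_term_skip x l Y : x \notin Y ->
  priority_term (x :: l) Y = priority_term l Y.
Proof. by rewrite priority_term.unlock /= => /negPf->. Qed.

Lemma rule_sideE K x y : x \in K -> rule_side E K x y = priority_term [:: x; y] K.
Proof.
move=> xK; rewrite priority_term_cons //; congr App; apply: eq_map => Z.
case: ifPn => [yZ|yZ]; last by rewrite priority_term_skip // priority_term_nil.
rewrite priority_term_cons //; congr App; apply: eq_map => W.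
by rewrite priority_term_nil.
Qed.

Lemma sort_priority_term l Y : sort_of (priority_term l Y) = Y.
Proof.
elim: l => [|x l IH]; first by rewrite priority_term_nil.
by case: (boolP (x \in Y)) => xY; [rewrite priority_term_cons | rewrite priority_term_skip].
Qed.

Lemma well_sorted_priority_term l Y : Y \in Sat E -> well_sorted E (priority_term l Y).
Proof.
elim: l Y => [|x l IH] Y YS; first by rewrite priority_term_nil.
case: (boolP (x \in Y)) => xY; last by rewrite priority_term_skip ?IH.
rewrite priority_term_cons //= YS xY -map_comp (eq_map (sort_priority_term l)).
rewrite map_id eqxx andbT /= all_map; apply/allP => W WY.
exact/IH/(comps_Sat hE YS WY).
Qed.

Lemma priority_term_filter l V Y : Y \in Sat E -> Y \subset V ->
  priority_term [seq v <- l | v \in V] Y = priority_term l Y.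
Proof.
elim: l Y => //= x l IH Y YS sYV; case: (boolP (x \in V)) => xV; last first.
  by rewrite IH // priority_term_skip // (contra (subsetP sYV x)).
case: (boolP (x \in Y)) => xY; last by rewrite !priority_term_skip // IH.
rewrite !priority_term_cons //; congr App; apply/eq_in_map => W WY.
apply: IH; first exact: comps_Sat WY.
exact: subset_trans (comps_sub hE YS WY) (subset_trans (subD1set _ _) sYV).
Qed.

(** The vertices of [l] outside [Y] are skipped, in [Y] and in all the components
met later. *)
Lemma eq_priority_term l l' Y : Y \in Sat E ->
  [seq v <- l | v \in Y] = [seq v <- l' | v \in Y] ->
  priority_term l Y = priority_term l' Y.
Proof.
move=> YS e; rewrite -(priority_term_filter l YS (subxx Y)) e.
exact: priority_term_filter.
Qed.

(** The variables are the components of what is left after all the removals, so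
they depend on the set of removed vertices only. *)
Lemma mem_vars_priority_term l Y Z : Y \in Sat E ->
  (Z \in vars (priority_term l Y)) = component E (Y :\: [set:: l]) Z.
Proof.
elim: l Y => [|x l IH] Y YS.
  by rewrite priority_term_nil set_nil setD0 component_self // inE.
rewrite set_cons; case: (boolP (x \in Y)) => xY; last first.
  rewrite (priority_term_skip _ xY) (IH _ YS) -setDDl; congr (component E (_ :\: _) Z).
  by apply/esym/setDidPl; rewrite disjoint_sym disjoints1.
rewrite priority_term_cons //= -map_comp.
apply/flatten_mapP/(component_comps _ _ _ hE YS) => -[W WY ZW];
  by exists W; move: ZW; rewrite //= IH ?(comps_Sat hE YS WY).
Qed.

Lemma vars_perm l l' Y : Y \in Sat E -> l =i l' ->
  vars (priority_term l Y) =i vars (priority_term l' Y).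
Proof.
move=> YS ell Z; rewrite !mem_vars_priority_term //.
by congr (component E (_ :\: _) Z); apply/setP => v; rewrite !inE.
Qed.

Lemma mem_bigcup_seq (s : seq {set T}) v :
  (v \in \bigcup_(Z <- s) Z) = has (fun Z : {set T} => v \in Z) s.
Proof. by elim: s => [|Z s IH]; rewrite ?big_nil ?big_cons inE //= IH. Qed.

Lemma vars_cover l Y : Y \in Sat E ->
  \bigcup_(Z <- vars (priority_term l Y)) Z = Y :\: [set:: l].
Proof.
move=> YS; apply/setP => v; rewrite mem_bigcup_seq; apply/hasP/idP => [[Z]|vY].
  by rewrite mem_vars_priority_term // => /component_sub/subsetP; apply.
have /setDP[vY' _] := vY; have vE := subsetP (Sat_cover YS) _ vY'.
have v1: [set v] \subset Y :\: [set:: l] by rewrite sub1set.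
have [Z cZ] := component_ex (Sat1 hE vE) v1 (set11 v); rewrite sub1set => vZ.
by exists Z; rewrite ?mem_vars_priority_term.
Qed.

(** Hence a rule applies at the root of each of these terms that begins with the
two vertices of the rule. *)
Lemma subst_priority_term l1 l2 Y : Y \in Sat E ->
  subst (priority_term l2) (priority_term l1 Y) = priority_term (l1 ++ l2) Y.
Proof.
elim: l1 Y => [|x l IH] Y YS; first by rewrite priority_term_nil.
case: (boolP (x \in Y)) => xY; last by rewrite /= !priority_term_skip // IH.
rewrite /= !priority_term_cons //=; congr App; rewrite -map_comp.
by apply/eq_in_map => W WY /=; apply/IH/(comps_Sat hE YS WY).
Qed.

(** Matching against these linear terms is deterministic: equal instances have
substitutions that agree on the variables. *)
Lemma eq_subst_priority_term l Y sigma tau :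
  subst sigma (priority_term l Y) = subst tau (priority_term l Y) <->
  {in vars (priority_term l Y), sigma =1 tau}.
Proof.
elim: l Y => [|x l IH] Y.
  rewrite priority_term_nil; split=> /= [e Z | e]; first by rewrite mem_seq1 => /eqP->.
  by apply: e; rewrite mem_head.
case: (boolP (x \in Y)) => xY; last by rewrite priority_term_skip.
rewrite priority_term_cons //= -!map_comp; split.
  case=> /eq_in_map e Z /flatten_mapP[W WY ZW].
  exact: (IH W).1 (e _ WY) Z ZW.
move=> e; congr App; apply/eq_in_map => W WY /=; apply/IH => Z ZW.
by apply: e; apply/flatten_mapP; exists W.
Qed.

Lemma eq_subst_perm l l' Y sigma tau : Y \in Sat E -> l =i l' ->
  subst sigma (priority_term l Y) = subst tau (priority_term l Y) ->
  subst sigma (priority_term l' Y) = subst tau (priority_term l' Y).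
Proof.
move=> YS ell /eq_subst_priority_term e; apply/eq_subst_priority_term => Z.
by rewrite -(vars_perm YS ell); apply: e.
Qed.

Lemma subst_Var_priority_term l Y :
  subst (@Var T) (priority_term l Y) = priority_term l Y.
Proof.
elim: l Y => [|x l IH] Y; first by rewrite priority_term_nil.
case: (boolP (x \in Y)) => xY; last by rewrite priority_term_skip.
by rewrite priority_term_cons //= -map_comp (eq_map (IH : _ =1 _)).
Qed.

Lemma sort_preserving_priority l : sort_preserving E (priority_term l).
Proof.
by move=> Y YS; rewrite sort_priority_term; split=> //; apply: well_sorted_priority_term.
Qed.

(** The components being disjoint, each vertex of [l] is removed at most once. *)
Lemma size_syms_priority_term l Y : Y \in Sat E ->
  size (syms (priority_term l Y)) <= \sum_(v <- l) (v \in Y).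
Proof.
elim: l Y => [|x l IH] Y YS; first by rewrite priority_term_nil.
rewrite big_cons; case: (boolP (x \in Y)) => xY; last first.
  by rewrite priority_term_skip // add0n IH.
rewrite priority_term_cons //= add1n ltnS -map_comp size_flatten /shape -map_comp.
rewrite sumnE big_map.
apply: (@leq_trans (\sum_(W <- comps E Y x) \sum_(v <- l) (v \in W))).
  rewrite big_seq [leqRHS]big_seq; apply: leq_sum => W WY.
  exact/IH/(comps_Sat hE YS WY).
rewrite exchange_big /=; apply: leq_sum => v _.
case: (boolP (has (fun W => v \in W) (comps E Y x))) => [/hasP[W WY vW]|nh]; last first.
  rewrite big1_seq // => W /andP[_ WY]; move/hasPn: nh => /(_ W WY).
  by move/negPf->.
rewrite (big_rem W WY) /= vW big1_seq ?addn0 => [|W' /andP[_ W'Y]].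
  by have /setD1P[_ ->] := subsetP (comps_sub hE YS WY) _ vW.
move: W'Y; rewrite mem_rem_uniq ?comps_uniq // !inE => /andP[nW W'Y].
by case: (boolP (v \in W')) => // vW'; rewrite (comps_inj hE YS W'Y WY vW' vW) eqxx in nW.
Qed.

End PriorityTerms.

(** * Rewriting steps and minimality *)

Section Steps.
Variables (d : Order.disp_t) (T : finOrderType d) (E : {set {set T}}).
Hypothesis hE : hypergraph E.
Implicit Types (U V W X Y Z K : {set T}) (x y z v : T) (l : seq T).
Implicit Types (s t : term T) (sigma tau : {set T} -> term T) (a b : step T).
Implicit Types (p q : seq nat).

Lemma is_stepP a : is_step E a <->
  [/\ well_sorted E (src a), is_rule E (rule_sort a) (rule_x a) (rule_y a)
    & exists C sigma,
      [/\ sort_preserving E sigma, hole_position C = pos a,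
          src a = fill C (subst sigma
            (priority_term E [:: rule_x a; rule_y a] (rule_sort a)))
        & tgt a = fill C (subst sigma
            (priority_term E [:: rule_y a; rule_x a] (rule_sort a)))]].
Proof.
by split=> -[ws r [C [sigma [sp ep es et]]]]; split=> //; exists C, sigma;
  move: es et; have [_ xK yK _] := r; rewrite /lhs /rhs !rule_sideE.
Qed.

(** A step is determined by its source, its position and its rule: the
left-hand side fixes the substitution on its variables, and the right-hand side
has the same variables. *)
Lemma step_eq a b : is_step E a -> is_step E b -> src a = src b ->
  pos a = pos b -> rule_sort a = rule_sort b -> rule_x a = rule_x b ->
  rule_y a = rule_y b -> a = b.
Proof.
case: a => sa ta p K x y; case: b => sb tb p' K' x' y'.
move=> /is_stepP/=[_ [KS _ _ _] [C [sigma [_ eC eas eat]]]].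
move=> /is_stepP/=[_ _ [D [tau [_ eD ebs ebt]]]] ess epp eK ex ey.
have eCD' : hole_position C = hole_position D by rewrite eC eD.
move: ess; rewrite eas ebs => /(fill_inj eCD')[eCD est]; subst.
by rewrite est (eq_subst_perm hE KS _ est) // => v; rewrite !in_cons orbCA.
Qed.

Lemma is_step_subst sigma a : sort_preserving E sigma -> is_step E a ->
  is_step E (step_subst sigma a).
Proof.
move=> ss [ws r [C [tau [st eC es et]]]]; split=> //.
  exact: (well_sorted_subst ss ws).1.
exists (subst_context sigma C), (fun Z => subst sigma (tau Z)); split.
- exact: sort_preserving_comp.
- by rewrite hole_position_subst.
- rewrite -[LHS]/(subst sigma (src a)) es subst_fill; congr fill; exact: subst_comp.
- rewrite -[LHS]/(subst sigma (tgt a)) et subst_fill; congr fill; exact: subst_comp.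
Qed.

Lemma syms_step a : is_step E a ->
  (rule_x a \in syms (src a)) /\ (rule_y a \in syms (src a)).
Proof.
move=> /is_stepP[_ [KS xK yK xy] [C [sigma [_ _ -> _]]]].
have yx : rule_y a != rule_x a by rewrite gt_eqF.
have [W WK yW] := comps_ex hE KS yK yx.
split; apply/syms_fill/syms_subst; rewrite priority_term_cons //= inE ?eqxx //.
rewrite -map_comp; apply/orP; right; apply/flatten_mapP; exists W => //=.
by rewrite priority_term_cons //= inE eqxx.
Qed.

Lemma critical_pairC a b : critical_pair E a b -> critical_pair E b a.
Proof.
case=> [[sa sb sab nab]] [p [q [pa qb pq]]] minC minS; split.
- by split=> // e; apply: nab.
- by exists q, p.
- move=> a' b' D [? ? ? nab'] ea eb; apply: (minC b' a') => //.
  by split=> // e; apply: nab'.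
- move=> a' b' sigma [? ? e nab'] ss ea eb; rewrite e.
  by apply: (minS b' a') => //; split=> // e'; apply: nab'.
Qed.

(** Minimality by counting function symbols.  Two steps that involve three
vertices need three function symbols in their source, so if there are no more,
a substitution can only map variables to variables; it then fixes them, as there
is one variable of each sort.  Minimality for contexts is clear when one of the
steps is at the root. *)
Lemma critical_pair_of_size a b u v w :
  step_pair E a b -> overlap E a b -> (pos a == [::]) || (pos b == [::]) ->
  uniq [:: u; v; w] ->
  {subset [:: u; v; w] <= [:: rule_x a; rule_y a; rule_x b; rule_y b]} ->
  size (syms (src a)) <= 3 -> critical_pair E a b.
Proof.
move=> sp ov root uuvw suvw sz; split=> //.
  move=> a' b' D _ ea eb; move: root; rewrite ea eb /=.
  by case: D {ea eb} => // ? ? ? ? ?.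
move=> a' b' sigma [sa' sb' e' _] ss ea eb Z ZV.
have sz3: 3 <= size (syms (src a')).
  apply: (uniq_leq_size (s1 := [:: u; v; w])) => // z /suvw.
  have [xa ya] := syms_step sa'; have [xb yb] := syms_step sb'.
  rewrite -e' in xb yb; rewrite ea eb /= !inE.
  by case/or4P=> /eqP->.
have ws' : well_sorted E (src a') by case: sa'.
have [wZ eZ] := ss Z (well_sorted_vars ws' ZV).
move: sz; rewrite ea /= size_syms_subst => sz.
have: size (syms (sigma Z)) = 0.
  have: size (syms (sigma Z)) <= sumn [seq size (syms (sigma Z)) | Z <- vars (src a')].
    by rewrite sumnE big_map (big_rem Z) //= leq_addr.
  case: (size (syms (sigma Z))) => // n h.
  by move: (leq_trans (leq_add sz3 h) sz); rewrite addnS ltnNge leq_addr.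
by move: eZ; case: (sigma Z) => //= Y ->.
Qed.

Lemma symbol_at_rule_side K x y p : symbol_at (rule_side E K x y) p ->
  p = [::] \/ exists2 i, p = [:: i] &
    i < size (comps E K x) /\ y \in nth set0 (comps E K x) i.
Proof.
have leafF (Z : {set T}) r : symbol_at (Var Z) r = false by case: r.
case: p => [|i p] /= H; [by left | right].
case: (ltnP i (size (comps E K x))) => [ik|ki]; last first.
  by rewrite nth_default ?size_map // leafF in H.
move: H; rewrite (nth_map set0) //; case: ifP => [yW|_]; last by rewrite leafF.
case: p => [|j p] /= H; first by exists i.
case: (ltnP j (size (components (restr E (nth set0 (comps E K x) i)) [set y]))) => hj.
  by rewrite (nth_map set0) // leafF in H.
by rewrite nth_default ?size_map // leafF in H.
Qed.

(** A step at position [p ++ q] is a step at position [q] put in a context whose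
hole is at [p]. *)
Lemma is_step_prefix a p q : is_step E a -> pos a = p ++ q ->
  exists C a', [/\ hole_position C = p, is_step E a' & a = step_in_context C a'].
Proof.
case: a => sa ta pa K x y [ws r [C [sigma [ss eC es et]]]] ep.
have [C0 [C1 [eC0 pC0 pC1]]] := context_split (etrans eC ep).
set L := subst sigma (lhs _ _) in es; set R := subst sigma (rhs _ _) in et.
have es' : sa = fill C0 (fill C1 L) by rewrite -fill_compose -eC0; exact: es.
have et' : ta = fill C0 (fill C1 R) by rewrite -fill_compose -eC0; exact: et.
exists C0, (Step (fill C1 L) (fill C1 R) q K x y); split=> //.
  split; [|exact: r|by exists C1, sigma; split; [|exact: pC1|exact: erefl|exact: erefl]].
  by apply: (@well_sorted_fill _ _ _ C0); rewrite -es'.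
rewrite es' et' (ep : pa = p ++ q) -pC0; exact: erefl.
Qed.

(** By minimality, the two steps of a critical pair have no common outer
context, as it could be removed from both. *)
Lemma critical_pair_prefix a b p q1 q2 : critical_pair E a b ->
  pos a = p ++ q1 -> pos b = p ++ q2 -> p = [::].
Proof.
case=> [[sa sb eab nab] _ minC _].
move=> /(is_step_prefix sa)[C [a' [pC sa' ea]]] /(is_step_prefix sb)[D [b' [pD sb' eb]]].
move: (eab); rewrite ea eb => /(fill_inj (etrans pC (esym pD)))[eCD eab'].
rewrite -pC (_ : C = Hole) //; apply: (minC a' b') => //; last by rewrite eCD.
by split=> // e; apply: nab; rewrite ea eb eCD e.
Qed.

End Steps.

(** * From terms to constructions by pruning *)

Section Chi.
Variables (d : Order.disp_t) (T : finOrderType d) (E : {set {set T}}).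
Hypothesis hE : hypergraph E.
Implicit Types (U V W X Y Z K : {set T}) (x y z v : T) (l : seq T).

Definition comp_of Y x y : {set T} :=
  nth set0 (comps E Y x) (find (fun W => y \in W) (comps E Y x)).

Lemma comp_ofP Y x y : Y \in Sat E -> y \in Y -> y != x ->
  comp_of Y x y \in comps E Y x /\ y \in comp_of Y x y.
Proof.
move=> YS yY yx; have [W WY yW] := comps_ex hE YS yY yx.
have h : has (fun W => y \in W) (comps E Y x) by apply/hasP; exists W.
by rewrite /comp_of mem_nth -?has_find // (nth_find set0 h).
Qed.

Lemma comp_of_eq Y x y W : Y \in Sat E -> W \in comps E Y x -> y \in W ->
  comp_of Y x y = W.
Proof.
move=> YS WY yW; have /setD1P[yx yY] := subsetP (comps_sub hE YS WY) _ yW.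
by have [cY yc] := comp_ofP YS yY yx; apply: (comps_inj hE YS cY WY yc).
Qed.

Lemma in_reconnected F X U : reflect
  (exists Z, [/\ Z \in Sat F, Z :&: X = U & U != set0]) (U \in reconnected F X).
Proof.
apply: (iffP imsetP) => [[Z]|[Z [ZS <- Z0]]].
  by rewrite inE => /andP[ZS Z0] ->; exists Z.
by exists Z => //; rewrite inE ZS.
Qed.

Lemma reconnected_hypergraph Y X : Y \in Sat E -> X \subset Y ->
  hypergraph (reconnected (restr E Y) X) /\ cover (reconnected (restr E Y) X) = X.
Proof.
move=> YS XY; set G := reconnected _ _; have YE := Sat_cover YS.
have cG : cover G \subset X.
  by apply/bigcupsP => U /in_reconnected[Z [_ <- _]]; apply: subsetIr.
have s1 v : v \in X -> [set v] \in G.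
  move=> vX; have vY := subsetP XY _ vX; have vE := subsetP YE _ vY.
  apply/in_reconnected; exists [set v]; split.
  - by rewrite Sat_restr // Sat1 // sub1set.
  - by apply/setIidPl; rewrite sub1set.
  - by apply/set0Pn; exists v; rewrite inE.
split.
  split=> [|v vG]; last by apply/s1/(subsetP cG).
  by apply/negP => /in_reconnected[Z [_ _]]; rewrite eqxx.
apply/eqP; rewrite eqEsubset cG; apply/subsetP => v vX.
by apply/bigcupP; exists [set v]; [exact: s1 | exact: set11].
Qed.

(** A connected set whose trace on the three vertices is [{y, z}] avoids [x], hence
lies in one component of [Y] minus [x]; conversely that component has the trace
[{y, z}]. *)
Lemma reconnected_pair Y x y z : Y \in Sat E -> uniq [:: x; y; z] ->
  [set x; y; z] \subset Y ->
  ([set y; z] \in reconnected (restr E Y) [set x; y; z]) = (z \in comp_of Y x y).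
Proof.
move=> YS; rewrite /= !inE !negb_or andbT => /andP[/andP[xy xz] yz].
rewrite !subUset !sub1set => /andP[/andP[xY yY] zY].
have yx : y != x by rewrite eq_sym.
have YE := Sat_cover YS; have [WY yW] := comp_ofP YS yY yx.
apply/in_reconnected/idP => [[Z [+ eZ _]]|zW].
  rewrite Sat_restr // => /andP[ZS sZY].
  have [yZ zZ] : y \in Z /\ z \in Z.
    by split; move/setP: eZ => /(_ _)/esym; [move/(_ y) | move/(_ z)];
      rewrite !inE eqxx ?orbT andbT.
  have xZ : x \notin Z.
    move/setP: eZ => /(_ x); rewrite !inE eqxx /= andbT => ->.
    by rewrite negb_or xy.
  have sZ : Z \subset Y :\ x by rewrite subsetD1 sZY.
  move: WY; rewrite mem_comps // => cW.
  exact: subsetP (component_max hE cW ZS sZ yZ yW) _ zZ.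
exists (comp_of Y x y); split; last by apply/set0Pn; exists y; rewrite !inE eqxx.
  rewrite Sat_restr // (comps_Sat hE YS WY).
  exact: subset_trans (comps_sub hE YS WY) (subD1set _ _).
apply/setP => v; rewrite !inE; case: (eqVneq v y) => [->|vy]; first by rewrite yW !orbT.
case: (eqVneq v z) => [->|vz]; first by rewrite zW !orbT.
rewrite !orbF; case: eqP => [->|_]; last by rewrite andbF.
by apply/negbTE; apply/negP => /andP[/(subsetP (comps_sub hE YS WY))]; rewrite !inE eqxx.
Qed.

(** Pruning keeps only the components that contain a vertex of interest.  Their
order does not matter, since [chi] sorts the remaining subtrees again. *)
Lemma perm_pmap_filter (S R : eqType) (f : S -> option R) (P : pred S) s s' :
  perm_eq (filter P s) s' -> {in s, forall u, ~~ P u -> f u = None} ->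
  perm_eq (pmap f s) (pmap f s').
Proof.
move=> ps fN; rewrite -(permPr (perm_pmap f ps)) (_ : pmap f (filter P s) = pmap f s) //.
elim: s fN {ps} => //= u s IH fN; case: ifPn => [_ /=|/fN->]; rewrite ?mem_head //=.
  by rewrite IH // => v vs; apply: fN; rewrite inE vs orbT.
by rewrite IH // => v vs; apply: fN; rewrite inE vs orbT.
Qed.

Lemma pmap_map (S S' R : Type) (f : S' -> option R) (g : S -> S') (s : seq S) :
  pmap f (map g s) = pmap (f \o g) s.
Proof. by elim: s => //= u s ->. Qed.

Lemma chi_priority_cons x l Y : x \in Y ->
  chi (priority_term E (x :: l) Y) =
    Some (CNode [set x] (sort (@tree_le d T)
            (pmap (fun W => chi (priority_term E l W)) (comps E Y x)))).
Proof. by move=> xY; rewrite priority_term_cons //= pmap_map. Qed.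

Lemma filter_comps_comp Y x y (P : pred {set T}) : Y \in Sat E -> y \in Y -> y != x ->
  {in comps E Y x, forall W, P W = (y \in W)} ->
  filter P (comps E Y x) = [:: comp_of Y x y].
Proof.
move=> YS yY yx eP; have [cY yc] := comp_ofP YS yY yx.
apply: perm_small_eq => //; apply: uniq_perm; rewrite ?filter_uniq ?comps_uniq //.
move=> W; rewrite mem_filter inE; apply/andP/eqP => [[PW WY]|->].
  by rewrite (comp_of_eq YS WY) // -eP.
by rewrite eP.
Qed.

Lemma chi_priority0 l Y : {in l, forall v, v \notin Y} ->
  chi (priority_term E l Y) = None.
Proof.
elim: l => [|x l IH] lY; first by rewrite priority_term_nil.
rewrite priority_term_skip ?lY ?mem_head //.
by apply: IH => v vl; rewrite lY // inE vl orbT.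
Qed.

Lemma chi_priority1 z l Y : Y \in Sat E -> z \in Y -> {in l, forall v, v \notin Y} ->
  chi (priority_term E (z :: l) Y) = Some (leaf z).
Proof.
move=> YS zY lY; rewrite chi_priority_cons //; congr (Some (CNode _ _)).
rewrite (_ : pmap _ _ = [::]) //; apply: perm_small_eq => //.
apply: (perm_pmap_filter (P := pred0) (s' := [::])); first by rewrite filter_pred0.
move=> W WY _; apply: chi_priority0 => v vl; apply: contra (lY v vl).
by move/(subsetP (comps_sub hE YS WY)); rewrite inE => /andP[].
Qed.

Lemma chi_priority2 y z Y : Y \in Sat E -> y != z -> y \in Y -> z \in Y ->
  chi (priority_term E [:: y; z] Y) = Some (CNode [set y] [:: leaf z]).
Proof.
move=> YS yz yY zY; rewrite chi_priority_cons //; congr (Some (CNode _ _)).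
have zy : z != y by rewrite eq_sym.
have [cY zc] := comp_ofP YS zY zy.
suff ->: pmap (fun W => chi (priority_term E [:: z] W)) (comps E Y y) = [:: leaf z] by [].
apply: perm_small_eq => //.
rewrite (permPl (perm_pmap_filter (P := fun W => z \in W) (s' := [:: comp_of Y y z]) _ _)).
- by rewrite /= chi_priority1 ?(comps_Sat hE YS cY).
- by rewrite (filter_comps_comp YS zY).
- by move=> W _ zW; apply: chi_priority0 => v; rewrite inE => /eqP->.
Qed.

Lemma support_leaf x : Defs.support (leaf x) = [set x].
Proof. by rewrite /Defs.support /= big_seq1. Qed.

(** One component of [Y] minus [x] survives the pruning if it contains both [y] and
[z], and two otherwise; this matches the two shapes of [tree3] by
[reconnected_pair]. *)
Lemma chi_priority3 Y x y z : Y \in Sat E -> uniq [:: x; y; z] ->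
  [set x; y; z] \subset Y ->
  chi (priority_term E [:: x; y; z] Y) =
    Some (tree3 (reconnected (restr E Y) [set x; y; z]) x y z).
Proof.
move=> YS u XY; rewrite /tree3 reconnected_pair //.
move: (u) (XY); rewrite /= !inE !negb_or andbT => /andP[/andP[xy xz] yz].
rewrite !subUset !sub1set => /andP[/andP[xY yY] zY].
have yx : y != x by rewrite eq_sym.
have zx : z != x by rewrite eq_sym.
have [cY yc] := comp_ofP YS yY yx; have [cY' zc] := comp_ofP YS zY zx.
rewrite chi_priority_cons //; congr (Some (CNode _ _)).
set f := fun W => _; pose P W := (y \in W) || (z \in W).
have fN W : ~~ P W -> f W = None.
  rewrite negb_or => /andP[yW zW]; apply: chi_priority0 => v.
  by rewrite !inE => /orP[] /eqP->.
case: ifPn => zW.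
  suff ->: pmap f (comps E Y x) = [:: CNode [set y] [:: leaf z]] by [].
  apply: perm_small_eq => //.
  rewrite (permPl (perm_pmap_filter (P := P) (s' := [:: comp_of Y x y]) _ _)).
  - by rewrite /= /f chi_priority2 ?(comps_Sat hE YS cY).
  - rewrite (filter_comps_comp YS yY) // => W WY; rewrite /P; apply: orb_idr => zW'.
    by rewrite -(comps_inj hE YS cY WY zW zW').
  - by move=> W _; exact: fN.
have yW' : y \notin comp_of Y x z.
  by apply: contra zW => yW'; rewrite (comp_of_eq YS cY').
have pf : perm_eq (pmap f (comps E Y x)) [:: leaf y; leaf z].
  rewrite (permPl (perm_pmap_filter (P := P) (s' := [:: comp_of Y x y;
    comp_of Y x z]) _ _)).
  - rewrite /= /f (chi_priority1 (comps_Sat hE YS cY) yc) => [|v]; last first.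
      by rewrite mem_seq1 => /eqP->.
    by rewrite priority_term_skip // (chi_priority1 (comps_Sat hE YS cY') zc).
  - apply: uniq_perm; rewrite ?filter_uniq ?comps_uniq //= ?inE ?andbT.
      by apply: contra zW => /eqP->.
    move=> W; rewrite mem_filter !inE /P; apply/andP/orP => [[/orP[yW|zW'] WY]|[]/eqP->].
    + by left; rewrite (comp_of_eq YS WY).
    + by right; rewrite (comp_of_eq YS WY).
    + by rewrite yc.
    + by rewrite zc orbT.
  - by move=> W _; exact: fN.
case: ltgtP yz => // lt_yz _; apply: sort_pair => //.
- by rewrite /tree_le !support_leaf max_le1 ltW.
- by rewrite /tree_le !support_leaf max_le1 -ltNge.
- by rewrite (permPl pf) (perm_catC [:: _] [:: _]).
- by rewrite /tree_le !support_leaf max_le1 ltW.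
- by rewrite /tree_le !support_leaf max_le1 -ltNge.
Qed.

Lemma chi_inv_priority3 Y x y z X : Y \in Sat E -> uniq [:: x; y; z] ->
  X = [set x; y; z] -> X \subset Y ->
  chi_inv E X Y (tree3 (reconnected (restr E Y) X) x y z)
    (priority_term E [:: x; y; z] Y).
Proof.
move=> YS u -> XY; split.
- exact: well_sorted_priority_term.
- exact: sort_priority_term.
- rewrite vars_cover //; congr (_ :\: _); apply/setP => v.
  by rewrite !inE orbA.
- exact: chi_priority3.
Qed.

End Chi.

(** * Polygons as critical confluence diagrams *)

Section Diagrams.
Variables (d : Order.disp_t) (T : finOrderType d) (E : {set {set T}}).
Hypothesis hE : hypergraph E.
Variables X Y : {set T}.
Hypotheses (YS : Y \in Sat E) (XY : X \subset Y).
Implicit Types (x y z v a b c : T).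
Let G := reconnected (restr E Y) X.
Notation pt := (priority_term E).

Lemma triangleE x y z : uniq [:: x; y; z] -> X = [set x; y; z] -> triangle G x y z.
Proof. by have [hG cG] := reconnected_hypergraph hE YS XY; split=> //; rewrite cG. Qed.

Lemma triangle_vertices x y z : triangle G x y z ->
  [/\ uniq [:: x; y; z], X = [set x; y; z], x \in Y, y \in Y & z \in Y].
Proof.
case=> _ u; have [_ ->] := reconnected_hypergraph hE YS XY => eX.
move: XY; rewrite {1}eX !subUset !sub1set => /andP[/andP[xY yY] zY].
by split.
Qed.

Lemma triangle_pair x y z : triangle G x y z ->
  ([set y; z] \in G) = (z \in comp_of E Y x y).
Proof.
move=> /triangle_vertices[u eX _ _ _].
by move: XY; rewrite /G eX => XY'; apply: reconnected_pair.
Qed.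

Lemma triangle_chi_inv x y z : triangle G x y z ->
  chi_inv E X Y (tree3 G x y z) (pt [:: x; y; z] Y).
Proof. by move=> /triangle_vertices[u eX _ _ _]; apply: chi_inv_priority3. Qed.

Definition root_step x y z : step T :=
  Step (pt [:: x; y; z] Y) (pt [:: y; x; z] Y) [::] Y x y.

Definition sub_step x y z : step T :=
  Step (pt [:: x; y; z] Y) (pt [:: x; z; y] Y)
    [:: index (comp_of E Y x y) (comps E Y x)] (comp_of E Y x y) y z.

Lemma is_step_root x y z : triangle G x y z -> (x < y)%O ->
  is_step E (root_step x y z).
Proof.
move=> /triangle_vertices[_ _ xY yY zY] xy; apply/is_stepP; split=> //=.
  exact: well_sorted_priority_term.
exists Hole, (pt [:: z]); split=> //=; first exact: sort_preserving_priority.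
  by rewrite subst_priority_term.
by rewrite subst_priority_term.
Qed.

(** Only the component that contains both [y] and [z] is changed: in all the others
neither of them is removed. *)
Lemma is_step_sub x y z : triangle G x y z -> (y < z)%O -> [set y; z] \in G ->
  is_step E (sub_step x y z).
Proof.
move=> tG yz yzG; have [u eX xY yY zY] := triangle_vertices tG.
have [xy xz _] := triangle_neq tG; have yx : y != x by rewrite eq_sym.
have [WY yW] := comp_ofP hE YS yY yx; have zW := yzG; rewrite (triangle_pair tG) in zW.
have WS := comps_Sat hE YS WY.
apply/is_stepP; rewrite /sub_step; set W := comp_of E Y x y in WY yW zW WS *.
set i := index W (comps E Y x); have iY : i < size (comps E Y x) by rewrite index_mem.
pose s1 := take i (comps E Y x); pose s2 := drop i.+1 (comps E Y x).
have eY : comps E Y x = s1 ++ W :: s2.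
  by rewrite -{1}(nth_index set0 WY) -/i -drop_nth // cat_take_drop.
have off V : V \in s1 ++ s2 -> pt [:: z; y] V = pt [:: y; z] V.
  move=> Vs; have /andP[VY VW] : (V \in comps E Y x) && (V != W).
    move: (comps_uniq E Y x) Vs; rewrite eY mem_cat uniq_catC /= !mem_cat inE.
    rewrite negb_or -andbA => /and3P[Ws2 Ws1 _] /orP[] Vs; rewrite Vs ?orbT /=;
    by apply: contraTneq Vs => ->.
  have [yV zV] : y \notin V /\ z \notin V.
    split; apply: contra VW => vV; apply/eqP.
      exact: (comps_inj hE YS VY WY vV yW).
    exact: (comps_inj hE YS VY WY vV zW).
  by rewrite !priority_term_skip.
split=> //=; first exact: well_sorted_priority_term.
exists (CApp x Y (map (pt [:: y; z]) s1) Hole (map (pt [:: y; z]) s2)), (@Var T).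
rewrite !subst_Var_priority_term; split=> //=.
- by rewrite size_map size_takel // ltnW.
- by rewrite priority_term_cons // eY map_cat.
- rewrite priority_term_cons // eY map_cat /=; congr (App _ _ (_ ++ _ :: _)).
    by apply/eq_in_map => V Vs; apply: off; rewrite mem_cat Vs.
  by apply/eq_in_map => V Vs; apply: off; rewrite mem_cat Vs orbT.
Qed.

(** When [y] and [z] are in different components of [Y] minus [x], no component sees
more than one of them, and their order is irrelevant. *)
Lemma priority_term_swap x y z : triangle G x y z -> [set y; z] \notin G ->
  pt [:: x; y; z] Y = pt [:: x; z; y] Y.
Proof.
move=> tG yzG; have [u eX xY yY zY] := triangle_vertices tG.
rewrite (triangle_pair tG) in yzG.
rewrite !priority_term_cons //; congr App; apply/eq_in_map => V VY.
apply: (eq_priority_term hE); first exact: comps_Sat VY.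
case: (boolP (y \in V)) => yV; case: (boolP (z \in V)) => zV;
  rewrite /= ?(negPf yV) ?(negPf zV) ?yV ?zV //.
by rewrite (comp_of_eq hE YS VY yV) zV in yzG.
Qed.

(** The counterparts of [side_c] and [side_b]. *)
Definition steps_c a b c : seq (step T) :=
  (if [set b; c] \in G then [:: sub_step a b c] else [::])
  ++ root_step a c b :: (if [set a; b] \in G then [:: sub_step c a b] else [::]).

Definition steps_b a b c : seq (step T) :=
  root_step a b c :: (if [set a; c] \in G then [:: sub_step b a c] else [::])
  ++ [:: root_step b c a].

Section OrderedTriple.
Variables a b c : T.
Hypotheses (tG : triangle G a b c) (ab : (a < b)%O) (bc : (b < c)%O).

Let ac : (a < c)%O := lt_trans ab bc.
Let t_bac := triangle_swap12 tG.
Let t_acb := triangle_swap23 tG.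
Let t_cab := triangle_swap12 t_acb.
Let t_bca := triangle_swap23 t_bac.
Let t_cba := triangle_swap23 t_cab.

Lemma reduction_cat s l1 t l2 u : reduction E s l1 t -> reduction E t l2 u ->
  reduction E s (l1 ++ l2) u.
Proof. by elim: l1 s => [s /= ->|e l1 IH s [ste es /IH r] /r] //=. Qed.

Lemma reduction_steps_c :
  reduction E (pt [:: a; b; c] Y) (steps_c a b c) (pt [:: c; b; a] Y).
Proof.
apply: (@reduction_cat _ _ (pt [:: a; c; b] Y)).
  case: ifPn => h /=; [split=> //; exact: is_step_sub | exact: priority_term_swap].
split=> //=; first exact: is_step_root.
case: ifPn => h /=; [split=> //; exact: is_step_sub | exact: priority_term_swap].
Qed.

Lemma reduction_steps_b :
  reduction E (pt [:: a; b; c] Y) (steps_b a b c) (pt [:: c; b; a] Y).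
Proof.
split=> //=; first exact: is_step_root.
apply: (@reduction_cat _ _ (pt [:: b; c; a] Y)).
  case: ifPn => h /=; [split=> //; exact: is_step_sub | exact: priority_term_swap].
split=> //=; exact: is_step_root.
Qed.

Lemma boundary_diagram_steps :
  boundary_diagram E X Y (steps_c a b c) (steps_b a b c) /\
  boundary_diagram E X Y (steps_b a b c) (steps_c a b c).
Proof.
have bd := oriented_boundary_sides tG ab bc.
have bd' : oriented_boundary G (side_b G a b c) (side_c G a b c).
  move: bd; rewrite /side_c /side_b; case: ifP => _; exact: oriented_boundaryC.
have tc : List.Forall2 (transported E X Y) (side_c G a b c) (steps_c a b c).
  rewrite /side_c /steps_c; case: ifP => _; case: ifP => _ /=;
    repeat (apply List.Forall2_cons; first by split; exact: triangle_chi_inv);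
    exact: List.Forall2_nil.
have tb : List.Forall2 (transported E X Y) (side_b G a b c) (steps_b a b c).
  rewrite /side_b /steps_b; case: ifP => _ /=;
    repeat (apply List.Forall2_cons; first by split; exact: triangle_chi_inv);
    exact: List.Forall2_nil.
by split; [exists (side_c G a b c), (side_b G a b c)
         | exists (side_b G a b c), (side_c G a b c)].
Qed.

Definition first_c : step T :=
  if [set b; c] \in G then sub_step a b c else root_step a c b.

(** The rules of the two steps share the symbol [a] at the root if [b] and [c] are
separated by [a], and else the symbol [b] just below it. *)
Lemma critical_pair_first : critical_pair E first_c (root_step a b c).
Proof.
have [u _ aY bY cY] := triangle_vertices tG.
have [nab nac nbc] := triangle_neq tG.
rewrite /first_c; case: ifPn => h.
- apply: (@critical_pair_of_size _ _ _ hE _ _ a b c) => //.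
  + split; [exact: is_step_sub | exact: is_step_root | by [] | ].
    by move/(congr1 (@pos d T)).
  + have nba : b != a by rewrite eq_sym.
    have [WY bW] := comp_ofP hE YS bY nba.
    exists [::], [:: index (comp_of E Y a b) (comps E Y a)]; split=> //=.
    by rewrite (nth_map set0) ?index_mem // nth_index // bW.
  + by move=> v; rewrite /= !inE; case/or3P=> /eqP->; rewrite eqxx ?orbT.
  + apply: leq_trans (size_syms_priority_term hE _ YS) _.
    by rewrite !big_cons big_nil aY bY cY.
- apply: (@critical_pair_of_size _ _ _ hE _ _ a b c) => //.
  + split; [exact: is_step_root | exact: is_step_root | | ].
      by rewrite /= (priority_term_swap tG h).
    by move/(congr1 (@rule_y d T)) => /= e; rewrite e eqxx in nbc.
  + by exists [::], [::].
  + by move=> v; rewrite /= !inE; case/or3P=> /eqP->; rewrite eqxx ?orbT.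
  + apply: leq_trans (size_syms_priority_term hE _ YS) _.
    by rewrite !big_cons big_nil aY bY cY.
Qed.

Lemma critical_diagram_steps : exists lc lb,
  [/\ boundary_diagram E X Y (first_c :: lc) (root_step a b c :: lb),
      boundary_diagram E X Y (root_step a b c :: lb) (first_c :: lc),
      critical_confluence_diagram E first_c lc (root_step a b c) lb
    & critical_confluence_diagram E (root_step a b c) lb first_c lc].
Proof.
have [bd bd'] := boundary_diagram_steps; have cp := critical_pair_first.
have rc := reduction_steps_c; have [_ _ rb] := reduction_steps_b.
have [lc elc] : exists lc, steps_c a b c = first_c :: lc.
  by rewrite /steps_c /first_c; case: ifP => _ /=; eexists.
rewrite elc in bd bd' rc; have [_ _ rc'] := rc.
exists lc, (behead (steps_b a b c)); split=> //.
  by split=> //; exists (pt [:: c; b; a] Y).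
by split; [exact: critical_pairC | exists (pt [:: c; b; a] Y)].
Qed.

End OrderedTriple.
End Diagrams.

(** * Critical pairs as initial edges of polygons *)

Section CriticalPairs.
Variables (d : Order.disp_t) (T : finOrderType d) (E : {set {set T}}).
Hypothesis hE : hypergraph E.
Implicit Types (K V W X Y Z : {set T}) (x y z u v w : T) (l : seq T).
Implicit Types (a b : step T) (sigma tau : {set T} -> term T).
Notation pt := (priority_term E).

(** Two matches, one of the whole term and one of its argument of sort [W], combine
into a match of a larger term: the variables inside [W] are told from the others
by inclusion, as the components are disjoint and non-empty. *)
Lemma subst_glue K x W l l' sigma tau : K \in Sat E -> x \in K ->
  W \in comps E K x -> subst sigma (pt l W) = subst tau (pt l' W) ->
  {in comps E K x, forall V, V != W -> pt l V = pt l' V} ->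
  subst sigma (pt (x :: l) K) =
    subst (fun Z => if Z \subset W then tau Z else sigma Z) (pt (x :: l') K).
Proof.
move=> KS xK WK eW eV; rewrite !priority_term_cons //=; congr App.
rewrite -!map_comp; apply/eq_in_map => V VK /=.
have VS := comps_Sat hE KS VK.
have subV Z : Z \in vars (pt l' V) -> Z != set0 /\ Z \subset V.
  rewrite mem_vars_priority_term // => cZ; split; first exact: Sat_neq0 (component_Sat cZ).
  exact: subset_trans (component_sub cZ) (subsetDl _ _).
case: (eqVneq V W) => [eVW | nVW].
  by rewrite eVW eW; apply/eq_subst_priority_term => Z; rewrite -eVW => /subV[_ ->].
rewrite eV //; apply/eq_subst_priority_term => Z /subV[/set0Pn[z zZ] sZ].
case: ifP => // sZW; case/eqP: nVW.
exact: (comps_inj hE KS VK WK (subsetP sZ _ zZ) (subsetP sZW _ zZ)).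
Qed.

(** If the source of a critical pair is an instance of the source of two steps with
the same rules and positions, then the critical pair is an instance of these two
steps, since steps are deterministic; by minimality the substitution is the
identity. *)
Lemma critical_pair_eq a b a' b' sigma l K : critical_pair E a b ->
  step_pair E a' b' -> sort_preserving E sigma -> src a' = pt l K ->
  src a = subst sigma (pt l K) ->
  [/\ pos a = pos a', rule_sort a = rule_sort a', rule_x a = rule_x a'
    & rule_y a = rule_y a'] ->
  [/\ pos b = pos b', rule_sort b = rule_sort b', rule_x b = rule_x b'
    & rule_y b = rule_y b'] ->
  a = a' /\ b = b'.
Proof.
case=> [[sa sb eab _] _ _ minS] sp ss ea' ea [pa Ka xa ya] [pb Kb xb yb].
have [sa' sb' eab' _] := sp.
have eqa : a = step_subst sigma a'.
  by apply: (step_eq hE sa (is_step_subst ss sa')); rewrite /= ?ea'.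
have eqb : b = step_subst sigma b'.
  by apply: (step_eq hE sb (is_step_subst ss sb')); rewrite /= -?eab -?eab' ?ea'.
have id_sigma : {in vars (pt l K), sigma =1 @Var T}.
  by move=> Z; rewrite -ea'; apply: minS eqa eqb Z.
have esrc : src a = src a'.
  rewrite ea ea' -[RHS]subst_Var_priority_term.
  exact/eq_subst_priority_term.
by split; apply: (step_eq hE) => //; rewrite -?eab -?eab'.
Qed.

Definition diagram_pair a b : Prop :=
  exists X Y u v w,
    [/\ X \subset Y, Y \in Sat E, triangle (reconnected (restr E Y) X) u v w,
        (u < v)%O & (v < w)%O] /\
    (a = first_c E X Y u v w /\ b = root_step E Y u v w).

Lemma hole_position0 (C : context T) : hole_position C = [::] -> C = Hole.
Proof. by case: C. Qed.

(** Two rules that apply at the same position share the root vertex [x] and move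
up vertices [y] and [y'] from two different components of the removal of
[x]. *)
Lemma critical_pair_root a b : critical_pair E a b -> pos a = [::] ->
  pos b = [::] -> diagram_pair a b \/ diagram_pair b a.
Proof.
move=> cp pa pb; have [[sa sb eab nab] _ _ _] := cp.
case/is_stepP: (sa) => _ [KS xK yK xy] [C [sigma [ss eC esa _]]].
case/is_stepP: (sb) => _ [KS' xK' yK' xy'] [D [tau [st eD esb _]]].
rewrite pa in eC; rewrite pb in eD.
rewrite (hole_position0 eC) /= in esa; rewrite (hole_position0 eD) /= in esb.
move: (eab); rewrite {1}esa {1}esb !priority_term_cons //= => -[exx eKK].
rewrite -!map_comp -exx -eKK => /eq_in_map eW.
set K := rule_sort a in KS xK yK esa eKK eW *.
set x := rule_x a in xK xy esa exx eW *.
set y := rule_y a in yK xy esa eW *.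
set y' := rule_y b in yK' xy' esb eW *.
rewrite -eKK in yK'; rewrite -exx in xy'.
have yx : y != x by rewrite gt_eqF.
have y'x : y' != x by rewrite gt_eqF.
have yy' : y != y'.
  by apply/eqP => e; apply: nab; apply: (step_eq hE) => //; rewrite pa pb.
have [W WK y'W] := comps_ex hE KS yK' y'x.
have yW : y \notin W.
  apply/negP => yW; have := eW _ WK; rewrite /= !priority_term_cons //= => -[e].
  by rewrite e eqxx in yy'.
have esrc : src a =
    subst (fun Z => if Z \subset W then tau Z else sigma Z) (pt [:: x; y; y'] K).
  rewrite esa; apply: (subst_glue (l' := [:: y; y'])) => //.
    rewrite [pt [:: y; y'] W]priority_term_skip //; exact: eW _ WK.
  move=> V VK nVW; apply: (eq_priority_term hE); first exact: comps_Sat VK.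
  have /negPf y'V : y' \notin V.
    by apply: contra nVW => y'V; apply/eqP/(comps_inj hE KS VK WK y'V y'W).
  by rewrite /= y'V.
pose X := [set x; y; y'].
have XK : X \subset K by rewrite !subUset !sub1set xK yK yK'.
have u3 : uniq [:: x; y; y'].
  by rewrite /= !inE negb_or [x == y]eq_sym yx [x == y']eq_sym y'x yy'.
have tG := triangleE hE KS XK u3 erefl.
have nG : [set y; y'] \notin reconnected (restr E K) X.
  rewrite (triangle_pair hE KS XK tG); have [cK yc] := comp_ofP hE KS yK yx.
  by apply: contra yW => y'c; rewrite -(comps_inj hE KS cK WK y'c y'W).
have tG' := triangle_swap23 tG.
have swap := priority_term_swap hE KS XK tG nG.
have sp : step_pair E (root_step E K x y y') (root_step E K x y' y).
  split; [| | exact: swap |]; try exact: (is_step_root hE KS XK).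
  by move/(congr1 (@rule_y d T)) => /= e; rewrite e eqxx in yy'.
have ss0 : sort_preserving E (fun Z => if Z \subset W then tau Z else sigma Z).
  by move=> Z ZS; case: ifP => _; [exact: st | exact: ss].
have [ea eb] := critical_pair_eq cp sp ss0 erefl esrc
  (And4 pa erefl erefl erefl) (And4 pb (esym eKK) (esym exx) erefl).
case: (ltgtP y y') yy' => // lt_yy' _; [right | left].
  by exists X, K, x, y, y'; split=> //; rewrite /first_c (negPf nG) ea eb.
exists X, K, x, y', y; split=> //.
by rewrite /first_c [[set y'; y]]setUC (negPf nG) ea eb.
Qed.

(** A rule that overlaps another one from below applies at the vertex [y] that
the other rule moves above the root [x], and moves up a vertex [y'] of the same
component of the removal of [x]. *)
Lemma critical_pair_below a b i : critical_pair E a b -> pos b = [::] ->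
  pos a = [:: i] -> i < size (comps E (rule_sort b) (rule_x b)) ->
  rule_y b \in nth set0 (comps E (rule_sort b) (rule_x b)) i ->
  diagram_pair a b.
Proof.
move=> cp pb pa ik; have [[sa sb eab nab] _ _ _] := cp.
case/is_stepP: (sa) => _ [KS' xK' yK' xy'] [C [tau [st eC esa _]]].
case/is_stepP: (sb) => _ [KS xK yK xy] [D [sigma [ss eD esb _]]].
rewrite pa in eC; rewrite pb in eD; rewrite (hole_position0 eD) /= in esb.
set K := rule_sort b in ik KS xK yK esb *.
set x := rule_x b in ik xK xy esb *.
set y := rule_y b in yK xy esb *.
set y' := rule_y a in yK' xy' esa *.
set W := nth set0 _ i => yW.
have WK : W \in comps E K x by apply: mem_nth.
have [exy eKW eW] : [/\ rule_x a = y, rule_sort a = W &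
    subst sigma (pt [:: y] W) = subst tau (pt [:: y; y'] W)].
  case: C eC esa => [//|x0 K0 ts1 C ts2] [ei /hole_position0->] esa.
  rewrite (priority_term_cons _ _ xK) in esb.
  have [_ _] := etrans (esym esa) (etrans eab esb).
  (* Both steps describe the argument number [i] of the source. *)
  move/(congr1 (fun ts => nth (Var set0) ts i)); rewrite -map_comp.
  rewrite nth_cat ei ltnn subnn (nth_map set0 _ _ ik) -/W.
  rewrite [nth _ _ 0]/= [X in _ = X]/=.
  clear esa esb eab KS' xy' st sa.
  move: tau (rule_x a) (rule_sort a) xK' => {}tau x' K' xK'.
  rewrite (priority_term_cons _ _ yW) (priority_term_cons _ _ xK') => -[ex eK ets].
  subst x' K'; split; [exact: erefl | exact: erefl |].
  by rewrite (priority_term_cons _ [:: y'] yW) /= ets.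
rewrite eKW in yK'; rewrite exy in xy'.
have yx : y != x by rewrite gt_eqF.
have y'y : y' != y by rewrite gt_eqF.
have /setD1P[y'x y'K] := subsetP (comps_sub hE KS WK) _ yK'.
have esrc : src a =
    subst (fun Z => if Z \subset W then tau Z else sigma Z) (pt [:: x; y; y'] K).
  rewrite eab esb; apply: subst_glue => // V VK nVW.
  apply: (eq_priority_term hE); first exact: comps_Sat VK.
  have /negPf y'V : y' \notin V.
    by apply: contra nVW => y'V; apply/eqP/(comps_inj hE KS VK WK y'V yK').
  by rewrite /= y'V.
pose X := [set x; y; y'].
have XK : X \subset K by rewrite !subUset !sub1set xK yK y'K.
have u3 : uniq [:: x; y; y'].
  by rewrite /= !inE negb_or [x == y]eq_sym yx [x == y']eq_sym y'x eq_sym y'y.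
have tG := triangleE hE KS XK u3 erefl.
have cW : comp_of E K x y = W := comp_of_eq hE KS WK yW.
have yy'G : [set y; y'] \in reconnected (restr E K) X.
  by rewrite (triangle_pair hE KS XK tG) cW.
have sp : step_pair E (sub_step E K x y y') (root_step E K x y y').
  split; [exact: (is_step_sub hE KS XK) | exact: (is_step_root hE KS XK) | by [] |].
  by move/(congr1 (@pos d T)).
have ss0 : sort_preserving E (fun Z => if Z \subset W then tau Z else sigma Z).
  by move=> Z ZS; case: ifP => _; [exact: st | exact: ss].
have pa' : pos a = pos (sub_step E K x y y').
  by rewrite /= cW index_uniq ?comps_uniq.
have [ea eb] := critical_pair_eq cp sp ss0 erefl esrc
  (And4 pa' (etrans eKW (esym cW)) exy erefl) (And4 pb erefl erefl erefl).
by exists X, K, x, y, y'; split=> //; rewrite /first_c yy'G.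
Qed.

(** The left-hand sides have function symbols at the root and at one of its
arguments only, so the positions of overlapping steps differ by one level at
most. *)
Lemma critical_pair_classified a b : critical_pair E a b ->
  diagram_pair a b \/ diagram_pair b a.
Proof.
move=> cp; have [_ [p [q [pa qb epq]]] _ _] := cp; have cpC := critical_pairC cp.
have root s : s = s ++ [::] :> seq nat by rewrite cats0.
case: (symbol_at_rule_side pa) (symbol_at_rule_side qb) =>
    [ep | [i ep [ik iy]]] [eq | [j eq [jk jy]]];
  rewrite {}ep {}eq ?cats0 in pa qb epq.
- have pb0 := critical_pair_prefix cp (etrans epq (root _)) (root _).
  by apply: critical_pair_root => //; rewrite epq.
- have pb0 := critical_pair_prefix cp epq (root _).
  by left; apply: (critical_pair_below (i := j)) => //; rewrite epq pb0.
- have pa0 := critical_pair_prefix cp (root _) (esym epq).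
  by right; apply: (critical_pair_below (i := i)) => //; rewrite -epq pa0.
- have epos : pos a = pos b.
    by move: epq; rewrite !cats1 => /rcons_inj[].
  have pb0 := critical_pair_prefix cp (etrans epos (root _)) (root _).
  by apply: critical_pair_root => //; rewrite epos.
Qed.

Lemma card3_sorted X : #|X| = 3 -> exists u v w,
  [/\ X = [set u; v; w], uniq [:: u; v; w], (u < v)%O & (v < w)%O].
Proof.
move=> X3; pose s := sort <=%O (enum X).
have us : uniq s by rewrite sort_uniq enum_uniq.
have ss : sorted <%O s by rewrite sort_lt_sorted enum_uniq.
have sz : size s = 3 by rewrite size_sort -cardE.
have ms : s =i X by move=> v; rewrite mem_sort mem_enum.
case: s us ss sz ms => [|u [|v [|w []]]] // us /and3P[uv vw _] _ ms.
exists u, v, w; split=> //.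
by apply/setP => z; rewrite -ms !inE orbA.
Qed.

End CriticalPairs.

Theorem proposition3p27 (d : Order.disp_t) (T : finOrderType d)
    (E : {set {set T}}) (hE : hypergraph E) (cE : connected E) :
  (forall X Y : {set T}, X \subset Y -> Y \in Sat E -> #|X| = 3 ->
     exists (a : step T) (la : seq (step T)) (b : step T) (lb : seq (step T)),
       boundary_diagram E X Y (a :: la) (b :: lb) /\
       critical_confluence_diagram E a la b lb) /\
  (forall a b : step T, critical_pair E a b ->
     exists (X Y : {set T}) (la lb : seq (step T)),
       [/\ X \subset Y, Y \in Sat E, #|X| = 3,
           boundary_diagram E X Y (a :: la) (b :: lb)
         & critical_confluence_diagram E a la b lb]).
Proof.
split=> [X Y XY YS /card3_sorted[u [v [w [eX u3 uv vw]]]] | a b].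
  have tG := triangleE hE YS XY u3 eX.
  have [lc [lb [bd _ cd _]]] := critical_diagram_steps hE YS XY tG uv vw.
  by exists (first_c E X Y u v w), lc, (root_step E Y u v w), lb.
have card3 (X Y : {set T}) u v w : X \subset Y -> Y \in Sat E ->
    triangle (reconnected (restr E Y) X) u v w -> #|X| = 3.
  move=> XY YS tG; have [_ eX _ _ _] := triangle_vertices hE YS XY tG.
  have [uv uw vw] := triangle_neq tG.
  rewrite eX setUC cardsU1 cards2 !inE uv [w == u]eq_sym [w == v]eq_sym.
  by rewrite (negPf uw) (negPf vw).
case/(critical_pair_classified hE) => -[X [Y [u [v [w [[XY YS tG uv vw] [-> ->]]]]]]];
  have [lc [lb [bd bd' cd cd']]] := critical_diagram_steps hE YS XY tG uv vw.
  by exists X, Y, lc, lb; split=> //; exact: card3 tG.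
by exists X, Y, lb, lc; split=> //; exact: card3 tG.
Qed.
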